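(* A $\circ$-Hopf algebra $H$ with antipode $S$ is a compact quantum group if and only if it is cosemisimple and the normal integral $\varphi:H\to\mathbb{C}$ is positive definite in the sense that $\varphi(S(x^\circ)x)>0$ for all $0\ne x\in H$.
   Context: Everything is over $\mathbb{C}$. A $\circ$-structure on a coalgebra is a conjugate linear involution $c\mapsto c^\circ$ with $\Delta(c^\circ)=\sum c_2^\circ\otimes c_1^\circ$. A $\circ$-Hopf algebra is a Hopf algebra $H$ with a $\circ$-structure on its underlying coalgebra such that $(xy)^\circ=x^\circ y^\circ$. A unitary inner product on a right $H$-comodule $V$ (with coaction $v\mapsto\sum v_0\otimes v_1$) is an inner product (linear in the first, conjugate linear in the second variable) with $\sum\langle u_0,v\rangle u_1=\sum\langle u,v_0\rangle v_1^\circ$ for all $u,v$. A compact quantum group is a $\circ$-Hopf algebra $H$ such that every right $H$-comodule admits a unitary inner product. If $H$ is cosemisimple (the direct sum of its simple subcoalgebras, one of which is $\mathbb{C}1$), the normal integral $\varphi:H\to\mathbb{C}$ is the projection of $H$ onto $\mathbb{C}1\cong\mathbb{C}$ along the sum of the other simple subcoalgebras; it satisfies $\sum\varphi(x_1)x_2=\varphi(x)1=\sum x_1\varphi(x_2)$ and $\varphi(1)=1$. *)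

(* Defs.v *)
From HB Require Import structures.
From mathcomp Require Import all_boot all_order all_algebra.
From mathcomp Require Import sesquilinear generic_quotient.
From mathcomp Require Import boolp classical_sets reals.
From mathcomp.real_closed Require Export complex.

Set Implicit Arguments.
Unset Strict Implicit.
Unset Printing Implicit Defensive.

Import GRing.Theory Num.Theory.

Local Open Scope ring_scope.
Local Open Scope quotient_scope.
Local Open Scope classical_set_scope.

Reserved Notation "x ⊗ y" (at level 45, no associativity).
Reserved Notation "\tsum_ ( x ⊗ y <- t ) E"
  (at level 36, E at level 36, x, y at level 40, t at level 45,
   format "\tsum_ ( x  ⊗  y  <-  t )  E").

Section TensorProduct.
Variables (K : comNzRingType) (V W : lmodType K).

(* A list of pairs stands for the sum of the corresponding pure tensors. *)
Inductive tens_equiv : seq (V * W) -> seq (V * W) -> Prop :=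
| tens_refl s : tens_equiv s s
| tens_sym s t : tens_equiv s t -> tens_equiv t s
| tens_trans t s u : tens_equiv s t -> tens_equiv t u -> tens_equiv s u
| tens_cat s s' t t' :
    tens_equiv s s' -> tens_equiv t t' -> tens_equiv (s ++ t) (s' ++ t')
| tens_catC s t : tens_equiv (s ++ t) (t ++ s)
| tens_zero w : tens_equiv [:: (0, w)] [::]
| tens_addl v v' w : tens_equiv [:: (v + v', w)] [:: (v, w); (v', w)]
| tens_addr v w w' : tens_equiv [:: (v, w + w')] [:: (v, w); (v, w')]
| tens_scale a v w : tens_equiv [:: (a *: v, w)] [:: (v, a *: w)].

Definition tens_rel (s t : seq (V * W)) : bool := `[< tens_equiv s t >].

Fact tens_rel_refl : reflexive tens_rel.
Proof. by move=> s; apply/asboolP; apply: tens_refl. Qed.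
Fact tens_rel_sym : symmetric tens_rel.
Proof. by move=> s t; apply/asboolP/asboolP; apply: tens_sym. Qed.
Fact tens_rel_trans : transitive tens_rel.
Proof.
by move=> t s u /asboolP st /asboolP tu; apply/asboolP; apply: tens_trans st tu.
Qed.

Canonical tens_rel_equiv :=
  EquivRel tens_rel tens_rel_refl tens_rel_sym tens_rel_trans.

Definition tensor : Type := {eq_quot tens_rel_equiv}.
HB.instance Definition _ := Choice.on tensor.
HB.instance Definition _ : EqQuotient _ tens_rel_equiv tensor :=
  EqQuotient.on tensor.

Definition pure (v : V) (w : W) : tensor := \pi_tensor [:: (v, w)].

Let pi_eq s t : tens_equiv s t <-> \pi_tensor s = \pi_tensor t.
Proof.
split=> [st|/eqP]; first by apply/eqP; rewrite eqmodE; apply/asboolP.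
by rewrite eqmodE => /asboolP.
Qed.

Let scale_list (a : K) (s : seq (V * W)) := [seq (a *: p.1, p.2) | p <- s].

Let scale_list_equiv a s t :
  tens_equiv s t -> tens_equiv (scale_list a s) (scale_list a t).
Proof.
rewrite /scale_list; elim=> {s t} /=.
- by move=> s; apply: tens_refl.
- by move=> s t _; apply: tens_sym.
- by move=> t s u _ st _; apply: tens_trans.
- by move=> s s' t t' _ ss _ tt; rewrite !map_cat; apply: tens_cat.
- by move=> s t; rewrite !map_cat; apply: tens_catC.
- by move=> w; rewrite scaler0; apply: tens_zero.
- by move=> v v' w; rewrite scalerDr; apply: tens_addl.
- by move=> v w w'; apply: tens_addr.
- by move=> b v w; rewrite scalerA mulrC -scalerA; apply: tens_scale.
Qed.

Let repr_pi s : tens_equiv (repr (\pi_tensor s)) s.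
Proof. by apply/pi_eq; rewrite reprK. Qed.

Let tadd (x y : tensor) : tensor := \pi_tensor (repr x ++ repr y).
Let tzero : tensor := \pi_tensor [::].
Let tscale (a : K) (x : tensor) : tensor := \pi_tensor (scale_list a (repr x)).
Let topp (x : tensor) : tensor := tscale (-1) x.

Let pi_add s t : tadd (\pi_tensor s) (\pi_tensor t) = \pi_tensor (s ++ t).
Proof. by apply/pi_eq; apply: tens_cat; apply: repr_pi. Qed.
Let pi_scale a s : tscale a (\pi_tensor s) = \pi_tensor (scale_list a s).
Proof. by apply/pi_eq; apply: scale_list_equiv; apply: repr_pi. Qed.

Let pi_surj x : exists s, x = \pi_tensor s.
Proof. by exists (repr x); rewrite reprK. Qed.

Let taddA : associative tadd.
Proof.
move=> x y z; have [s ->] := pi_surj x; have [t ->] := pi_surj y.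
by have [u ->] := pi_surj z; rewrite !pi_add catA.
Qed.
Let taddC : commutative tadd.
Proof.
move=> x y; have [s ->] := pi_surj x; have [t ->] := pi_surj y.
by rewrite !pi_add; apply/pi_eq/tens_catC.
Qed.
Let tadd0 : left_id tzero tadd.
Proof. by move=> x; have [s ->] := pi_surj x; rewrite pi_add. Qed.

Let tscale_addl a b x : tscale (a + b) x = tadd (tscale a x) (tscale b x).
Proof.
have [t ->] := pi_surj x; rewrite !pi_scale pi_add; apply/pi_eq.
elim: t => [|[v w] t IHs] /=; first exact: tens_refl.
rewrite -/(scale_list a t) -/(scale_list b t).
set A := scale_list a t in IHs *; set B := scale_list b t in IHs *.
apply: (@tens_trans (([:: (a *: v, w)] ++ [:: (b *: v, w)]) ++ (A ++ B))).
  rewrite -cat1s; apply: tens_cat => //.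
  by rewrite scalerDl; apply: tens_addl.
rewrite -(cat1s _ (A ++ _)) -(cat1s _ B) -catA; apply: tens_cat (tens_refl _) _.
by rewrite !catA; apply: tens_cat (tens_catC _ _) (tens_refl _).
Qed.

Let tscale0 x : tscale 0 x = tzero.
Proof.
have [t ->] := pi_surj x; rewrite pi_scale; apply/pi_eq.
elim: t => [|[v w] s IHs] /=; first exact: tens_refl.
rewrite -[_ :: _]cat1s -[[::]]cat0s; apply: tens_cat => //.
by rewrite scale0r; apply: tens_zero.
Qed.

Let tscale1 : left_id 1 tscale.
Proof.
move=> x; have [t ->] := pi_surj x; rewrite pi_scale; congr (\pi_tensor _).
rewrite /scale_list -[RHS]map_id; apply: eq_map => -[v w] /=.
by rewrite scale1r.
Qed.

Let taddN : left_inverse tzero topp tadd.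
Proof. by move=> x; rewrite -{2}(tscale1 x) -tscale_addl addNr tscale0. Qed.

HB.instance Definition _ :=
  GRing.isZmodule.Build tensor taddA taddC tadd0 taddN.

Let tscaleA a b x : tscale a (tscale b x) = tscale (a * b) x.
Proof.
have [t ->] := pi_surj x; rewrite !pi_scale; congr (\pi_tensor _).
by rewrite /scale_list -map_comp; apply: eq_map => p /=; rewrite scalerA.
Qed.
Let tscaleDr : right_distributive tscale +%R.
Proof.
move=> a x y; have [s ->] := pi_surj x; have [t ->] := pi_surj y.
by rewrite [_ + _]pi_add !pi_scale [RHS]pi_add /scale_list map_cat.
Qed.
Let tscaleDl x : {morph tscale^~ x : a b / a + b}.
Proof. by move=> a b; apply: tscale_addl. Qed.

HB.instance Definition _ := GRing.Zmodule_isLmodule.Build K tensor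
  tscaleA tscale1 tscaleDr tscaleDl.

Lemma pureDl v v' w : pure (v + v') w = pure v w + pure v' w.
Proof. by rewrite [RHS]pi_add; apply/pi_eq/tens_addl. Qed.
Lemma pureDr v w w' : pure v (w + w') = pure v w + pure v w'.
Proof. by rewrite [RHS]pi_add; apply/pi_eq/tens_addr. Qed.
Lemma pureZl a v w : pure (a *: v) w = a *: pure v w.
Proof. by rewrite [RHS]pi_scale. Qed.
Lemma pureZr a v w : pure v (a *: w) = a *: pure v w.
Proof. by rewrite -pureZl; apply/esym/pi_eq/tens_scale. Qed.

Lemma tensor_repr (t : tensor) : t = \sum_(p <- repr t) pure p.1 p.2.
Proof.
rewrite -[LHS]reprK; elim: (repr t) => [|[v w] s IHs]; first by rewrite big_nil.
by rewrite big_cons -IHs [RHS]pi_add.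
Qed.

Definition balanced (U : nmodType) (f : V -> W -> U) : Prop :=
  [/\ forall v v' w, f (v + v') w = f v w + f v' w,
      forall v w w', f v (w + w') = f v w + f v w',
      forall w, f 0 w = 0
    & forall a v w, f (a *: v) w = f v (a *: w)].

(* Sweedler sums: f t1 t2 summed over a chosen expression of t as a sum of pure
   tensors t1 ⊗ t2.  The result is independent of that choice (tsumE) when f is
   balanced; below, tsum is only applied to balanced f. *)
Definition tsum (U : nmodType) (f : V -> W -> U) (t : tensor) : U :=
  \sum_(p <- repr t) f p.1 p.2.

Let tsum_equiv (U : nmodType) (f : V -> W -> U) s t :
  balanced f -> tens_equiv s t ->
  \sum_(p <- s) f p.1 p.2 = \sum_(p <- t) f p.1 p.2.
Proof.
case=> fDl fDr f0 fZ; elim=> {s t} //=.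
- by move=> t s u _ -> _ ->.
- by move=> s s' t t' _ ss _ tt; rewrite !big_cat /= ss tt.
- by move=> s t; rewrite !big_cat /= addrC.
- by move=> w; rewrite big_seq1 big_nil f0.
- by move=> v v' w; rewrite !big_cons !big_nil !addr0 fDl.
- by move=> v w w'; rewrite !big_cons !big_nil !addr0 fDr.
- by move=> a v w; rewrite !big_seq1 fZ.
Qed.

Lemma tsumE (U : nmodType) (f : V -> W -> U) (s : seq (V * W)) :
  balanced f ->
  tsum f (\sum_(p <- s) pure p.1 p.2) = \sum_(p <- s) f p.1 p.2.
Proof.
move=> bf; apply: tsum_equiv => //; apply/pi_eq; rewrite reprK.
elim: s => [|[v w] s IHs]; first by rewrite big_nil.
by rewrite big_cons IHs [LHS]pi_add.
Qed.

Lemma tsum_pure (U : nmodType) (f : V -> W -> U) v w :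
  balanced f -> tsum f (pure v w) = f v w.
Proof. by move=> bf; have := tsumE [:: (v, w)] bf; rewrite !big_seq1. Qed.

Lemma tsumD (U : nmodType) (f : V -> W -> U) t t' :
  balanced f -> tsum f (t + t') = tsum f t + tsum f t'.
Proof.
move=> bf; rewrite {1}(tensor_repr t) {1}(tensor_repr t') -big_cat /=.
by rewrite tsumE // big_cat.
Qed.

End TensorProduct.

Notation "x ⊗ y" := (pure x y) : ring_scope.
Notation "\tsum_ ( x ⊗ y <- t ) E" := (tsum (fun x y => E) t) : ring_scope.

HB.mixin Record isCoalgebra (K : fieldType) C of GRing.Lmodule K C := {
  comul : {linear C -> tensor C C};
  counit : {scalar C};
  comulA : forall c : C,
    \tsum_(c1 ⊗ c2 <- comul c) \tsum_(x ⊗ y <- comul c1) (x ⊗ (y ⊗ c2)) =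
    \tsum_(c1 ⊗ c2 <- comul c) (c1 ⊗ comul c2);
  counitl : forall c : C, \tsum_(c1 ⊗ c2 <- comul c) (counit c1 *: c2) = c;
  counitr : forall c : C, \tsum_(c1 ⊗ c2 <- comul c) (counit c2 *: c1) = c
}.
#[short(type="coalgType")]
HB.structure Definition Coalgebra (K : fieldType) :=
  {C of isCoalgebra K C & GRing.Lmodule K C}.

HB.mixin Record isHopfAlgebra (K : fieldType) H
    of GRing.Algebra K H & Coalgebra K H := {
  comul1 : comul (1 : H) = 1 ⊗ 1;
  comulM : forall x y : H, comul (x * y) =
    \tsum_(x1 ⊗ x2 <- comul x) \tsum_(y1 ⊗ y2 <- comul y)
      ((x1 * y1) ⊗ (x2 * y2));
  counit1 : counit (1 : H) = 1;
  counitM : forall x y : H, counit (x * y) = counit x * counit y;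
  antipode : {linear H -> H};
  antipodel : forall x : H,
    \tsum_(x1 ⊗ x2 <- comul x) (antipode x1 * x2) = counit x *: 1;
  antipoder : forall x : H,
    \tsum_(x1 ⊗ x2 <- comul x) (x1 * antipode x2) = counit x *: 1
}.
#[short(type="hopfAlgType")]
HB.structure Definition HopfAlgebra (K : fieldType) :=
  {H of isHopfAlgebra K H & GRing.Algebra K H & Coalgebra K H}.

HB.mixin Record hasCirc (K : numClosedFieldType) C of Coalgebra K C := {
  circ : {linear C -> C | Num.conj \; *:%R};
  circK : involutive circ;
  comul_circ : forall c : C,
    comul (circ c) = \tsum_(c1 ⊗ c2 <- comul c) (circ c2 ⊗ circ c1)
}.
#[short(type="circCoalgType")]
HB.structure Definition CircCoalgebra (K : numClosedFieldType) :=
  {C of hasCirc K C & Coalgebra K C}.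

HB.mixin Record isCircHopfAlgebra (K : numClosedFieldType) H
    of HopfAlgebra K H & CircCoalgebra K H := {
  circM : {morph (circ : H -> H) : x y / x * y}
}.
#[short(type="circHopfAlgType")]
HB.structure Definition CircHopfAlgebra (K : numClosedFieldType) :=
  {H of isCircHopfAlgebra K H & HopfAlgebra K H & CircCoalgebra K H}.

Section Cosemisimple.
Variables (K : fieldType) (C : coalgType K).
Implicit Types D E : set C.

Definition subspace D : Prop :=
  D 0 /\ forall (a : K) (u v : C), D u -> D v -> D (a *: u + v).

(* The image of D ⊗ D in C ⊗ C. *)
Definition tensor_square D : set (tensor C C) :=
  [set t | exists2 s : seq (C * C),
     (forall p, p \in s -> D p.1 /\ D p.2) & t = \sum_(p <- s) (p.1 ⊗ p.2)].

Definition subcoalgebra D : Prop :=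
  subspace D /\ forall c, D c -> tensor_square D (comul c).

Definition simple_subcoalgebra D : Prop :=
  [/\ subcoalgebra D, D <> [set 0] &
      forall E, subcoalgebra E -> E `<=` D -> E = [set 0] \/ E = D].

Definition sum_of (P : set (set C)) : set C :=
  [set c | exists (n : nat) (D : 'I_n -> set C) (d : 'I_n -> C),
     (forall i, P (D i) /\ D i (d i)) /\ c = \sum_(i < n) d i].

Definition independent (P : set (set C)) : Prop :=
  forall (n : nat) (D : 'I_n -> set C) (d : 'I_n -> C),
    injective D -> (forall i, P (D i) /\ D i (d i)) ->
    \sum_(i < n) d i = 0 -> forall i, d i = 0.

Definition cosemisimple : Prop :=
  sum_of simple_subcoalgebra = setT /\ independent simple_subcoalgebra.

End Cosemisimple.
Arguments cosemisimple {K} C.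

Section NormalIntegral.
Variables (K : fieldType) (H : hopfAlgType K).

Definition scalars : set H := [set x | exists a : K, x = a *: 1].

Definition other_simple : set (set H) :=
  [set D | simple_subcoalgebra D /\ D <> scalars].

(* The scalar a such that a *: 1 is the component of x in
   H = scalars (+) sum_of other_simple; this decomposition exists and is unique
   when H is cosemisimple, and the value is meaningless otherwise. *)
Definition normal_integral (x : H) : K :=
  xget 0 [set a : K | sum_of other_simple (x - a *: 1)].

End NormalIntegral.

Section Comodules.
Variables (K : fieldType) (H : coalgType K) (V : lmodType K).

Definition right_comodule (rho : {linear V -> tensor V H}) : Prop :=
  (forall v : V,
     \tsum_(v0 ⊗ v1 <- rho v) \tsum_(x ⊗ y <- rho v0) (x ⊗ (y ⊗ v1)) =
     \tsum_(v0 ⊗ v1 <- rho v) (v0 ⊗ comul v1)) /\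
  (forall v : V, \tsum_(v0 ⊗ v1 <- rho v) (counit v1 *: v0) = v).

End Comodules.

Section CompactQuantumGroups.
Variables (K : numClosedFieldType) (H : circHopfAlgType K).

Definition unitary (V : lmodType K) (rho : {linear V -> tensor V H})
    (ip : {dot V for Num.conj}) : Prop :=
  forall u v : V,
    \tsum_(u0 ⊗ u1 <- rho u) (ip u0 v *: u1) =
    \tsum_(v0 ⊗ v1 <- rho v) (ip u v0 *: circ v1).

Definition compact_quantum_group : Prop :=
  forall (V : lmodType K) (rho : {linear V -> tensor V H}),
    right_comodule rho -> exists ip : {dot V for Num.conj}, unitary rho ip.

End CompactQuantumGroups.

(* Main.v *)
(* Throughout, h(x,y) = phi(S(y°) x) for an integral phi.  It is invariant for
   the regular comodule, so if it is positive definite, every comodule V embeds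
   through its coaction in a direct sum of copies of H, indexed by a Hamel basis
   of V, and inherits a unitary inner product.

   Conversely let H be a compact quantum group, with unitary inner products [,]
   on the regular comodule and {,} on the comodule x |-> x2 ⊗ T(x1), where
   T(x) = S(x°)°.  Then phi(x) = [x,1]/[1,1] is an integral.  Every invariant form
   k on the regular comodule satisfies sum k(x1,y1) h(x2,y2) = k(x,y), and every
   invariant form k on the other one satisfies sum h(x1,y1) k(x2,y2) = k(x,y).
   Applied to h and to its adjoint, these identities show that h is hermitian.
   Diagonalise h against [,] on a finite-dimensional right coideal: for an
   eigenvector a with eigenvalue mu,
     {a,a} = sum h(a1,a1') {a2,a2'} = mu sum [a1,a1'] {a2,a2'},
   and both sums are squared norms, so mu > 0 and h is positive definite.
   Since h is invariant on both sides, orthogonal complements of subcoalgebras are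
   subcoalgebras, which gives cosemisimplicity by induction on the dimension;
   finally phi is the normal integral because normalised integrals are unique. *)

Require Import Defs.
From HB Require Import structures.
From mathcomp Require Import all_boot all_order all_algebra.
From mathcomp Require Import ring sesquilinear spectral.
From mathcomp Require Import boolp classical_sets reals.

Set Implicit Arguments.
Unset Strict Implicit.
Unset Printing Implicit Defensive.

Import Order.TTheory GRing.Theory Num.Theory.

Local Open Scope ring_scope.
Local Open Scope classical_set_scope.
Local Open Scope sesquilinear_scope.

(** * Linear maps and Sweedler sums *)

Section Linear.
Variable K : fieldType.
Implicit Types U V W X Y : lmodType K.

(** Linearity is an unbundled predicate, so that nested Sweedler sums written as lambda terms can be
    proved linear by the tactic [lin] instead of being bundled. *)
Definition lin U V (f : U -> V) : Prop :=
  forall a u v, f (a *: u + v) = a *: f u + f v.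

Definition blin U V W (f : U -> V -> W) : Prop :=
  (forall v, lin (f^~ v)) /\ (forall u, lin (f u)).

Definition tlin U V W X (f : U -> V -> W -> X) : Prop :=
  [/\ forall v w, lin (fun u => f u v w), forall u w, lin (fun v => f u v w)
    & forall u v, lin (f u v)].

Definition linform U (f : U -> K) : Prop := @lin U K^o f.

Definition bilform U V (f : U -> V -> K) : Prop := @blin U V K^o f.

Lemma linD U V (f : U -> V) u v : lin f -> f (u + v) = f u + f v.
Proof. by move=> fl; rewrite -[u]scale1r fl !scale1r. Qed.
Lemma lin0 U V (f : U -> V) : lin f -> f 0 = 0.
Proof. by move=> fl; apply: (addrI (f 0)); rewrite -linD // !addr0. Qed.
Lemma linZ U V (f : U -> V) a u : lin f -> f (a *: u) = a *: f u.
Proof. by move=> fl; rewrite -[a *: u]addr0 fl (lin0 fl) addr0. Qed.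
Lemma linN U V (f : U -> V) u : lin f -> f (- u) = - f u.
Proof. by move=> fl; rewrite -!scaleN1r linZ. Qed.
Lemma linB U V (f : U -> V) u v : lin f -> f (u - v) = f u - f v.
Proof. by move=> fl; rewrite linD // linN. Qed.
Lemma lin_sum U V (f : U -> V) I r (P : pred I) F : lin f ->
  f (\sum_(i <- r | P i) F i) = \sum_(i <- r | P i) f (F i).
Proof.
by move=> fl; apply: (big_morph f) => [u v|]; rewrite ?linD // lin0.
Qed.

Lemma lin_linear U V (f : {linear U -> V}) : lin f.
Proof. by move=> a u v; rewrite linearP. Qed.

Lemma lin_id U : lin (fun x : U => x). Proof. by []. Qed.
Lemma lin_app U V W (f : {linear V -> W}) (g : U -> V) :
  lin g -> lin (fun x => f (g x)).
Proof. by move=> gl a u v; rewrite gl linearP. Qed.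
Lemma lin_comp U V W (f : V -> W) (g : U -> V) :
  lin f -> lin g -> lin (fun x => f (g x)).
Proof. by move=> fl gl a u v; rewrite gl fl. Qed.
Lemma lin_blinl U V W X (f : V -> W -> X) (g : U -> V) w :
  blin f -> lin g -> lin (fun x => f (g x) w).
Proof. by case=> fl _; apply: lin_comp (fl w). Qed.
Lemma lin_blinr U V W X (f : V -> W -> X) (g : U -> W) v :
  blin f -> lin g -> lin (fun x => f v (g x)).
Proof. by case=> _ fl; apply: lin_comp (fl v). Qed.
Lemma lin_tlin1 U V W X Y (f : V -> W -> X -> Y) (g : U -> V) w y :
  tlin f -> lin g -> lin (fun x => f (g x) w y).
Proof. by case=> fl _ _; apply: lin_comp (fl w y). Qed.
Lemma lin_tlin2 U V W X Y (f : V -> W -> X -> Y) (g : U -> W) v y :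
  tlin f -> lin g -> lin (fun x => f v (g x) y).
Proof. by case=> _ fl _; apply: lin_comp (fl v y). Qed.
Lemma lin_tlin3 U V W X Y (f : V -> W -> X -> Y) (g : U -> X) v w :
  tlin f -> lin g -> lin (fun x => f v w (g x)).
Proof. by case=> _ _ fl; apply: lin_comp (fl v w). Qed.
Lemma lin_scalel U V (g : U -> K^o) (v : V) : lin g -> lin (fun x => g x *: v).
Proof. by move=> gl a u w; rewrite gl scalerDl scalerA. Qed.
Lemma lin_scaler U V (g : U -> V) c : lin g -> lin (fun x => c *: g x).
Proof. by move=> gl a u w; rewrite gl scalerDr !scalerA mulrC. Qed.
Lemma lin_mull U (A : algType K) (g : U -> A) c : lin g -> lin (fun x => g x * c).
Proof. by move=> gl a u w; rewrite gl mulrDl scalerAl. Qed.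
Lemma lin_mulr U (A : algType K) (g : U -> A) c : lin g -> lin (fun x => c * g x).
Proof. by move=> gl a u w; rewrite gl mulrDr scalerAr. Qed.
Lemma lin_kmull U (g : U -> K^o) (c : K) : lin g -> lin (fun x => g x * c : K^o).
Proof. exact: lin_mull. Qed.
Lemma lin_kmulr U (g : U -> K^o) (c : K) : lin g -> lin (fun x => c * g x : K^o).
Proof. exact: lin_mulr. Qed.
Lemma lin_purel U V W (g : U -> V) (w : W) : lin g -> lin (fun x => g x ⊗ w).
Proof. by move=> gl a u v; rewrite gl pureDl pureZl. Qed.
Lemma lin_purer U V W (g : U -> W) (v : V) : lin g -> lin (fun x => v ⊗ g x).
Proof. by move=> gl a u w; rewrite gl pureDr pureZr. Qed.
Lemma lin_bigsum U V I (r : seq I) (F : I -> U -> V) :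
  (forall i, lin (F i)) -> lin (fun x => \sum_(i <- r) F i x).
Proof.
move=> Fl a u v; rewrite scaler_sumr -big_split /=.
by apply: eq_bigr => i _; rewrite Fl.
Qed.
Lemma lin_tsum_body U V W X (F : U -> V -> W -> X) t :
  (forall v w, lin (fun x => F x v w)) -> lin (fun x => tsum (F x) t).
Proof. by move=> Fl; apply: lin_bigsum. Qed.

Lemma blin_balanced U V W (f : U -> V -> W) : blin f -> balanced f.
Proof.
case=> fl fr; split=> [v v' w|v w w'|w|a v w].
- exact: (linD _ _ (fl w)).
- exact: (linD _ _ (fr v)).
- exact: (lin0 (fl w)).
- by rewrite (linZ _ _ (fl w)) (linZ _ _ (fr v)).
Qed.

Lemma tsumZ U V W (f : U -> V -> W) a t : blin f -> tsum f (a *: t) = a *: tsum f t.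
Proof.
move=> fl; rewrite {1}[t]tensor_repr scaler_sumr /tsum scaler_sumr -/(tsum _ _).
under eq_bigr => p _ do rewrite -pureZl.
rewrite -(big_map (fun p => (a *: p.1, p.2)) predT (fun p => p.1 ⊗ p.2)).
rewrite tsumE ?big_map; last exact: blin_balanced.
by apply: eq_bigr => p _ /=; case: fl => fl _; rewrite (linZ _ _ (fl p.2)).
Qed.

Lemma lin_tsum U V W X (f : U -> V -> W) (g : X -> tensor U V) :
  blin f -> lin g -> lin (fun x => tsum f (g x)).
Proof.
move=> fl gl a u v; rewrite gl tsumD ?tsumZ //; exact: blin_balanced.
Qed.

Lemma eq_tsum U V (W : nmodType) (f g : U -> V -> W) t :
  (forall u v, f u v = g u v) -> tsum f t = tsum g t.
Proof. by move=> fg; apply: eq_bigr => p _; rewrite fg. Qed.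

Lemma lin_tsumE U V W X (g : W -> X) (f : U -> V -> W) t :
  lin g -> g (tsum f t) = tsum (fun u v => g (f u v)) t.
Proof. exact: lin_sum. Qed.

Lemma exchange_tsum U V U' V' (W : nmodType) (f : U -> V -> U' -> V' -> W) s t :
  tsum (fun a b => tsum (f a b) t) s = tsum (fun c d => tsum (fun a b => f a b c d) s) t.
Proof. exact: exchange_big. Qed.

Lemma tsum_blin_pure U V W (f : U -> V -> W) u v : blin f -> tsum f (u ⊗ v) = f u v.
Proof. by move=> fl; rewrite tsum_pure //; apply: blin_balanced. Qed.

Lemma tsum_sum U V (W : nmodType) (f : U -> V -> W) I (r : seq I) x y :
  balanced f ->
  tsum f (\sum_(i <- r) (x i ⊗ y i)) = \sum_(i <- r) f (x i) (y i).
Proof.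
move=> fb; rewrite -(big_map (fun i => (x i, y i)) predT (fun p => p.1 ⊗ p.2)).
by rewrite tsumE // big_map.
Qed.

Lemma tsum_tsum_pure U V U' V' (W : nmodType) (f : U -> V -> W)
    (g : U' -> V' -> U) (h : U' -> V' -> V) t : balanced f ->
  tsum f (tsum (fun a b => g a b ⊗ h a b) t) = tsum (fun a b => f (g a b) (h a b)) t.
Proof.
by move=> fb; rewrite {2}/tsum tsum_sum.
Qed.

Lemma balanced_swap U V U' V' (W : nmodType) (f : U -> V -> W)
    (g : {linear U' -> U}) (h : {linear V' -> V}) : balanced f ->
  balanced (fun b a => f (g a) (h b)).
Proof.
case=> fl fr f0 fZ; split=> [v v' w|v w w'|w|a v w].
- by rewrite linearD fr.
- by rewrite linearD fl.
- by rewrite linear0 -[0](scale0r 0) -fZ scale0r f0.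
- by rewrite !linearZ fZ.
Qed.

Lemma tensor_ext U V W (f g : tensor U V -> W) :
  lin f -> lin g -> (forall u v, f (u ⊗ v) = g (u ⊗ v)) -> f =1 g.
Proof.
move=> fl gl fg t; rewrite [t]tensor_repr !lin_sum //.
by apply: eq_bigr => p _.
Qed.

End Linear.

(** Follows the syntax of the body down to its variable. Facts [lin], [blin] or [tlin] in the
    context serve as leaves, which is why some are introduced as anonymous hypotheses just before a
    call. *)
Ltac lin :=
  lazymatch goal with
  | |- linform _ => rewrite /linform; lin
  | |- bilform _ => rewrite /bilform; lin
  | |- blin _ => split=> ?; lin
  | |- tlin _ => split=> ? ?; lin
  | |- lin _ =>
    first
      [ assumption
      | exact: lin_id
      | exact: lin_linear
      | apply: lin_mull; lin
      | apply: lin_mulr; lin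
      | apply: lin_scalel; lin
      | apply: lin_scaler; lin
      | apply: lin_purel; lin
      | apply: lin_purer; lin
      | apply: lin_app; lin
      | apply: lin_tsum; [lin | lin]
      | apply: lin_tsum_body => ? ?; lin
      | eapply lin_comp; [eassumption | lin]
      | eapply lin_blinl; [eassumption | lin]
      | eapply lin_blinr; [eassumption | lin]
      | eapply lin_tlin1; [eassumption | lin]
      | eapply lin_tlin2; [eassumption | lin]
      | eapply lin_tlin3; [eassumption | lin] ]
  end.

Section Sweedler.
Variable K : fieldType.

(** The linear map on V ⊗ (H ⊗ H) induced by the trilinear [f] turns the coassociativity axiom into
    a rule for Sweedler sums with body [f]. *)
Lemma comodule_assoc (H : coalgType K) (V U : lmodType K)
    (rho : {linear V -> tensor V H}) (f : V -> H -> H -> U) v :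
  right_comodule rho -> tlin f ->
  tsum (fun a b => tsum (fun c d => f c d b) (rho a)) (rho v) =
  tsum (fun a b => tsum (f a) (comul b)) (rho v).
Proof.
case=> rhoA _ fl.
have gl : blin (fun a t => tsum (f a) t) by lin.
have /(congr1 (tsum (fun a t => tsum (f a) t))) := rhoA v.
rewrite (lin_tsumE (g := tsum _)); last by lin.
rewrite (lin_tsumE (g := tsum _)); last by lin.
under eq_tsum => a b.
  rewrite (lin_tsumE (g := tsum _)); last by lin.
  under eq_tsum => c d.
    rewrite tsum_blin_pure; last by lin.
    rewrite tsum_blin_pure; last by lin.
    over.
  over.
move=> ->; apply: eq_tsum => a b.
by rewrite tsum_blin_pure.
Qed.

Variable H : coalgType K.

Lemma comul_comodule : right_comodule (comul : {linear H -> tensor H H}).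
Proof. by split; [exact: comulA | exact: counitr]. Qed.

Lemma coassoc (U : lmodType K) (f : H -> H -> H -> U) x : tlin f ->
  tsum (fun a b => tsum (fun c d => f c d b) (comul a)) (comul x) =
  tsum (fun a b => tsum (f a) (comul b)) (comul x).
Proof. exact: (comodule_assoc x comul_comodule). Qed.

Lemma counitl_lin (U : lmodType K) (g : H -> U) x : lin g ->
  tsum (fun a b => counit a *: g b) (comul x) = g x.
Proof.
move=> gl; rewrite -[in RHS](counitl x) lin_tsumE //.
by apply: eq_tsum => a b; rewrite linZ.
Qed.

Lemma counitr_lin (U : lmodType K) (g : H -> U) x : lin g ->
  tsum (fun a b => counit b *: g a) (comul x) = g x.
Proof.
move=> gl; rewrite -[in RHS](counitr x) lin_tsumE //.
by apply: eq_tsum => a b; rewrite linZ.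
Qed.

End Sweedler.

(** * The antipode and invariance of integrals *)

Section Hopf.
Variables (K : fieldType) (H : hopfAlgType K).
Local Notation S := (antipode : {linear H -> H}).

(** The product of the tensor algebra H ⊗ H, the target of the convolution algebra in
    [comul_antipode]. *)
Definition tmul (t u : tensor H H) : tensor H H :=
  tsum (fun a b => tsum (fun c d => (a * c) ⊗ (b * d)) u) t.

Lemma tmul_lin : blin tmul.
Proof. by rewrite /tmul; lin. Qed.

Lemma tmul_pure (a b c d : H) : tmul (a ⊗ b) (c ⊗ d) = (a * c) ⊗ (b * d).
Proof.
by rewrite /tmul; do 2! [rewrite tsum_blin_pure; last by lin].
Qed.

Lemma tmulA t u v : tmul t (tmul u v) = tmul (tmul t u) v.
Proof.
have tl := tmul_lin.
move: t; apply: tensor_ext => [||a b]; first by lin.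
  by lin.
move: u; apply: tensor_ext => [||c d]; first by lin.
  by lin.
move: v; apply: tensor_ext => [||e f]; first by lin.
  by lin.
by rewrite !tmul_pure !mulrA.
Qed.

Lemma tmul1l t : tmul (1 ⊗ 1) t = t.
Proof.
have tl := tmul_lin.
move: t; apply: tensor_ext => [||a b]; first by lin.
  by lin.
by rewrite tmul_pure !mul1r.
Qed.

Lemma tmul1r t : tmul t (1 ⊗ 1) = t.
Proof.
have tl := tmul_lin.
move: t; apply: tensor_ext => [||a b]; first by lin.
  by lin.
by rewrite tmul_pure !mulr1.
Qed.

Lemma comul_tmul (x y : H) : comul (x * y) = tmul (comul x) (comul y).
Proof. exact: comulM. Qed.

(* Both sides are convolution inverses of comul in Hom (H, H ⊗ H). *)
Lemma comul_antipode (x : H) :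
  comul (S x) = tsum (fun a b => S b ⊗ S a) (comul x).
Proof.
have tl := tmul_lin.
pose G (y : H) := tsum (fun a b => S b ⊗ S a) (comul y).
have Gl : lin G by rewrite /G; lin.
(* [G] is a right convolution inverse of [comul]: after regrouping by coassociativity, first the
   inner pair and then the outer pair collapses by [antipoder]. *)
have DG (y : H) : tsum (fun a b => tmul (comul a) (G b)) (comul y) =
    counit y *: (1 ⊗ 1).
  transitivity (tsum (fun a b => tsum (fun c d =>
      tsum (fun e f : H => (e * S d : H) ⊗ (f * S c : H)) (comul a)) (comul b)) (comul y)).
    apply: eq_tsum => a b; rewrite /G lin_tsumE; last by lin.
    apply: eq_tsum => c d; rewrite /tmul; apply: eq_tsum => e f.
    by rewrite tsum_blin_pure //; lin.
  rewrite -(coassoc (f := fun a c d : H =>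
    tsum (fun e f : H => (e * S d : H) ⊗ (f * S c : H)) (comul a))); last by lin.
  transitivity (tsum (fun p d : H => (p * S d : H) ⊗ (1 : H)) (comul y)).
    apply: eq_tsum => p d.
    rewrite (coassoc (f := fun e f c : H => (e * S d : H) ⊗ (f * S c : H))); last by lin.
    rewrite -[RHS](counitr_lin (g := fun p : H => (p * S d : H) ⊗ (1 : H))); last by lin.
    apply: eq_tsum => e q; rewrite -pureZr -antipoder lin_tsumE //; lin.
  rewrite -pureZl -antipoder (lin_tsumE (g := fun z : H => z ⊗ (1 : H))) //; lin.
pose F (y : H) := comul (S y).
have Fl : lin F by rewrite /F; lin.
change (F x = G x).
rewrite -[LHS](counitr_lin (g := F)) // -[RHS](counitl_lin (g := G)) //.
(* With * for convolution, F = F * (comul * G) = (F * comul) * G = G; here F * comul is the unit by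
   [antipodel], since [comul] is multiplicative. *)
transitivity (tsum (fun a b =>
    tsum (fun c d => tmul (F a) (tmul (comul c) (G d))) (comul b)) (comul x)).
  apply: eq_tsum => a b.
  rewrite -[F a in LHS]tmul1r -(linZ _ _ (tmul_lin.2 (F a))) -DG.
  by rewrite lin_tsumE //; lin.
rewrite -(coassoc (f := fun a c d : H => tmul (F a) (tmul (comul c) (G d)))); last by lin.
apply: eq_tsum => p d.
rewrite -[G d in RHS]tmul1l -(linZ _ _ (tmul_lin.1 (G d))).
rewrite -comul1 -linearZ -antipodel /= (lin_tsumE (g := comul)); last by lin.
rewrite (lin_tsumE (g := fun t => tmul t (G d))); last by lin.
by apply: eq_tsum => a c; rewrite tmulA comul_tmul.
Qed.

Lemma tsum_comul_antipode (U : nmodType) (f : H -> H -> U) x : balanced f ->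
  tsum f (comul (S x)) = tsum (fun a b => f (S b) (S a)) (comul x).
Proof. by move=> fb; rewrite comul_antipode tsum_tsum_pure. Qed.

Lemma tsum_comulM (U : lmodType K) (f : H -> H -> U) x y : blin f ->
  tsum f (comul (x * y)) =
  tsum (fun a b => tsum (fun c d => f (a * c) (b * d)) (comul y)) (comul x).
Proof.
move=> [fl fr]; have fb : blin f by [].
rewrite comulM lin_tsumE; last by lin.
apply: eq_tsum => a b; rewrite lin_tsumE; last by lin.
by apply: eq_tsum => c d; rewrite tsum_blin_pure.
Qed.

Lemma tsum_comul_antipodeM (U : lmodType K) (f : H -> H -> U) x y : blin f ->
  tsum f (comul (S x * y)) =
  tsum (fun a b => tsum (fun c d => f (S b * c) (S a * d)) (comul y)) (comul x).
Proof.
move=> [fl fr]; have fb : blin f by [].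
by rewrite tsum_comulM // tsum_comul_antipode //; apply: blin_balanced; lin.
Qed.

Lemma counit_antipode (x : H) : counit (S x) = counit x.
Proof.
rewrite -[in LHS](counitr x) (lin_tsumE (g := S)); last by lin.
rewrite (lin_tsumE (g := counit : H -> K^o)); last by lin.
transitivity (counit (tsum (fun a b : H => S a * b) (comul x))).
  rewrite (lin_tsumE (g := counit : H -> K^o)); last by lin.
  by apply: eq_tsum => a b; rewrite linearZ linearZ counitM mulrC.
by rewrite antipodel linearZ /= counit1 [_ * _]mulr1.
Qed.

Definition integral (phi : H -> K) : Prop :=
  [/\ linform phi, phi 1 = 1,
      forall x, tsum (fun a b => phi a *: b) (comul x) = phi x *: 1
    & forall x, tsum (fun a b => phi b *: a) (comul x) = phi x *: 1].

(* For a form k, write B x a := k x (circ a); then this is the unitarity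
   of k for the regular comodule. *)
Definition right_inv (B : H -> H -> K) : Prop :=
  forall x a, tsum (fun x1 x2 => B x1 a *: x2) (comul x) =
              tsum (fun a1 a2 => B x a2 *: a1) (comul a).

(** Insert a1 S(a2) as a counit on the left. Since S reverses the coproduct, what follows a1 is the
    sum of phi(z1) z2 for z = S(a2) x, and the invariance of phi evaluates it. *)
Lemma integral_right_inv phi : integral phi ->
  right_inv (fun x a => phi (S a * x)).
Proof.
case=> phil _ phiL _ x a.
transitivity (tsum (fun p d => tsum (fun e g => phi (S d * e) *: (counit p *: g))
    (comul x)) (comul a)).
  rewrite exchange_tsum; apply: eq_tsum => e g.
  rewrite -[LHS](counitl_lin (g := fun a => phi (S a * e) *: g)); last by lin.
  by apply: eq_tsum => p d; rewrite !scalerA mulrC.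
transitivity (tsum (fun a1 q => a1 * (phi (S q * x) *: 1)) (comul a)); last first.
  by apply: eq_tsum => a1 q; rewrite -scalerAr mulr1.
transitivity (tsum (fun a1 q => tsum (fun c d =>
   tsum (fun e g => a1 * (phi (S d * e) *: (S c * g))) (comul x))
   (comul q)) (comul a)); last first.
  apply: eq_tsum => a1 q.
  rewrite -phiL tsum_comul_antipodeM; last by lin.
  rewrite (lin_tsumE (g := fun z => a1 * z)); last by lin.
  apply: eq_tsum => c d.
  by rewrite (lin_tsumE (g := fun z => a1 * z)); last by lin.
rewrite -(coassoc (f := fun a1 c d : H =>
   tsum (fun e g => a1 * (phi (S d * e) *: (S c * g))) (comul x))); last by lin.
apply: eq_tsum => p d; rewrite exchange_tsum; apply: eq_tsum => e g.
rewrite -[g in LHS]mul1r scalerAl -antipoder.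
rewrite (lin_tsumE (g := fun z => phi (S d * e) *: (z * g))); last by lin.
by apply: eq_tsum => b c; rewrite -scalerAr mulrA.
Qed.

End Hopf.

(** * The circ-structure and the coantipode *)

Section Circ.
Variables (K : numClosedFieldType) (H : circHopfAlgType K).
Local Notation S := (antipode : {linear H -> H}).

Lemma counitP a (x y : H) : counit (a *: x + y) = a * counit x + counit y.
Proof. exact: linearP. Qed.

Lemma circD (x y : H) : circ (x + y) = circ x + circ y.
Proof. exact: raddfD. Qed.

Lemma circZ a (x : H) : circ (a *: x) = a^* *: circ x.
Proof. exact: linearZ. Qed.

Lemma circ0 : circ (0 : H) = 0.
Proof. exact: raddf0. Qed.

Lemma circ1 : circ (1 : H) = 1.
Proof.
transitivity (circ (circ (1 : H))); last by rewrite circK.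
by rewrite -{2}[circ 1]mul1r circM circK mulr1.
Qed.

Lemma tsum_circ (U : nmodType) (f : H -> H -> U) x : balanced f ->
  tsum f (comul (circ x)) = tsum (fun a b => f (circ b) (circ a)) (comul x).
Proof. by move=> fb; rewrite comul_circ tsum_tsum_pure. Qed.

Lemma circ_tsum (V W : lmodType K) (f : V -> W -> H) t :
  circ (tsum f t) = tsum (fun a b => circ (f a b)) t.
Proof. by rewrite /tsum raddf_sum. Qed.

(** The conjugate of [counit (circ x)] is a left counit ([e1]), and a left counit agrees with the
    right counit [counit]. *)
Lemma counit_circ (x : H) : counit (circ x) = (counit x)^*.
Proof.
have e1 : tsum (fun a b => (counit (circ a))^* *: b) (comul x) = x.
  rewrite -[RHS]circK -[X in _ = circ X]counitr tsum_circ; last first.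
    by apply: blin_balanced; lin.
  by rewrite circ_tsum; apply: eq_tsum => a b; rewrite circZ circK.
have el : linform (fun a : H => (counit (circ a))^*).
  move=> a u v; rewrite circD circZ counitP rmorphD.
  by rewrite rmorphM /= conjCK.
apply: (can_inj (@conjCK K)); rewrite conjCK.
rewrite -[LHS](counitr_lin (g := (fun a => (counit (circ a))^*) : H -> K^o)) //.
rewrite -[x in RHS]e1 (lin_tsumE (g := counit : H -> K^o)); last by lin.
by apply: eq_tsum => a b /=; rewrite linearZ [LHS]mulrC.
Qed.

(** As [circ] is multiplicative and reverses the coproduct, this is the antipode for the opposite
    coproduct ([coantipodel], [coantipoder]). *)
Definition coantipode (x : H) : H := circ (S (circ x)).

Lemma coantipode_lin : lin coantipode.
Proof.
move=> a u v; rewrite /coantipode circD circZ linearD linearZ.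
by rewrite circD circZ conjCK.
Qed.

HB.instance Definition _ := GRing.isLinear.Build K H H *:%R coantipode
  coantipode_lin.

Local Notation T := (coantipode : {linear H -> H}).

Lemma coantipode_circ x : T (circ x) = circ (S x).
Proof. by rewrite /= /coantipode circK. Qed.

(** For bilinear [f] the new body is conjugate linear in both variables, hence not [blin]; it is
    still balanced, which is all that a change of representative in a Sweedler sum requires. *)
Lemma balanced_circ (U : nmodType) (f : H -> H -> U) :
  balanced f -> balanced (fun a b => f (circ b) (circ a)).
Proof.
case=> fl fr f0 fZ; split=> [v v' w|v w w'|w|a v w].
- by rewrite circD fr.
- by rewrite circD fl.
- by rewrite circ0 -[0](scale0r 0) -fZ scale0r f0.
- by rewrite !circZ fZ.
Qed.

Lemma tsum_comul_coantipode (U : lmodType K) (f : H -> H -> U) x : blin f ->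
  tsum f (comul (T x)) = tsum (fun a b => f (T b) (T a)) (comul x).
Proof.
move=> /blin_balanced fb; rewrite tsum_circ //.
have fb' := balanced_circ fb.
rewrite tsum_comul_antipode // tsum_circ //.
exact: (balanced_swap (f := fun a b => f (circ b) (circ a)) _ _ fb').
Qed.

Lemma counit_coantipode x : counit (T x) = counit x.
Proof. by rewrite counit_circ counit_antipode counit_circ conjCK. Qed.

Lemma coantipodel x : tsum (fun a b : H => T b * a) (comul x) = counit x *: 1.
Proof.
rewrite -[x]circK tsum_circ; last by apply: blin_balanced; lin.
rewrite [in RHS]counit_circ -[in RHS]circ1 -[RHS]circZ -antipodel circ_tsum.
by apply: eq_tsum => a b; rewrite circM coantipode_circ.
Qed.

Lemma coantipoder x : tsum (fun a b : H => b * T a) (comul x) = counit x *: 1.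
Proof.
rewrite -[x]circK tsum_circ; last by apply: blin_balanced; lin.
rewrite [in RHS]counit_circ -[in RHS]circ1 -[RHS]circZ -antipoder circ_tsum.
by apply: eq_tsum => a b; rewrite circM coantipode_circ.
Qed.

(* For a form k, write B x a := k x (circ a); then this is the unitarity
   of k for the comodule x |-> x2 ⊗ T x1. *)
Definition left_inv (B : H -> H -> K) : Prop :=
  forall x a, tsum (fun x1 x2 => B x2 a *: T x1) (comul x) =
              tsum (fun a1 a2 => B x a1 *: S a2) (comul a).

(** Mirror image of [integral_right_inv]: the other invariance of phi is applied to S(a) x2, and the
    adjacent factors coming from x collapse by [coantipoder]. This is why T, and not S, stands on
    the left. *)
Lemma integral_left_inv phi : integral phi ->
  left_inv (fun x a => phi (S a * x)).
Proof.
case=> phil _ _ phiR x a.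
transitivity (tsum (fun x1 q => tsum (fun c d => tsum (fun e g =>
    phi (S c * g) *: (S d * e * T x1)) (comul q)) (comul a)) (comul x)).
  apply: eq_tsum => x1 q; rewrite -[T x1 in LHS]mul1r scalerAl -phiR.
  rewrite tsum_comul_antipodeM; last by lin.
  rewrite (lin_tsumE (g := fun z => z * T x1)); last by lin.
  apply: eq_tsum => c d; rewrite (lin_tsumE (g := fun z => z * T x1)); last by lin.
  by apply: eq_tsum => e g; rewrite -scalerAl.
rewrite [LHS](eq_tsum (g := fun x1 q => tsum (fun e g => tsum (fun c d =>
  phi (S c * g) *: (S d * e * T x1)) (comul a)) (comul q))); last first.
  by move=> x1 q; rewrite exchange_tsum.
rewrite -(coassoc (f := fun x1 e g : H => tsum (fun c d =>
  phi (S c * g) *: (S d * e * T x1)) (comul a))); last by lin.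
transitivity (tsum (fun p g => tsum (fun c d => phi (S c * g) *: (counit p *: S d))
    (comul a)) (comul x)).
  apply: eq_tsum => p g; rewrite exchange_tsum; apply: eq_tsum => c d.
  rewrite -[S d in RHS]mulr1 scalerAr -coantipoder.
  rewrite (lin_tsumE (g := fun z => phi (S c * g) *: (S d * z))); last by lin.
  by apply: eq_tsum => u v; rewrite mulrA.
rewrite exchange_tsum; apply: eq_tsum => c d.
rewrite -[RHS](counitl_lin (g := fun z => phi (S c * z) *: S d)); last by lin.
by apply: eq_tsum => p g; rewrite !scalerA mulrC.
Qed.

End Circ.

(** * Convolution identities for invariant forms *)

Section InvariantForms.
Variables (K : numClosedFieldType) (H : circHopfAlgType K).
Local Notation S := (antipode : {linear H -> H}).
Local Notation T := (@coantipode K H : {linear H -> H}).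

Section Convolution.
Variables (phi : H -> K) (phi_lin : linform phi) (phi1 : phi 1 = 1).

(** Invariance of [B] moves the sum over the coproduct of [a] to that of [x]. There [antipodel]
    produces a counit inside phi, and phi(1) = 1 lets it out. *)
Lemma right_inv_conv (B : H -> H -> K) x a : bilform B -> right_inv B ->
  tsum (fun x1 x2 => tsum (fun a1 a2 =>
    (B x1 a2 * phi (S a1 * x2) : K^o)) (comul a)) (comul x) = B x a.
Proof.
move=> Bl BR.
transitivity (tsum (fun p x2 => tsum (fun u v =>
    (B u a * phi (S v * x2) : K^o)) (comul p)) (comul x)).
  apply: eq_tsum => p x2.
  pose g y : K^o := phi (S y * x2).
  have gl : lin g by rewrite /g; lin.
  have /(congr1 g) := BR p a.
  rewrite !(lin_tsumE (g := g)) // => e.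
  transitivity (tsum (fun a1 a2 => g (B p a2 *: a1)) (comul a)).
    by apply: eq_tsum => a1 a2; rewrite linZ.
  by rewrite -e; apply: eq_tsum => u v; rewrite linZ.
rewrite (coassoc (f := fun u v x2 => B u a * phi (S v * x2) : K^o)); last first.
  by split=> ? ?; [apply: lin_kmull|apply: lin_kmulr|apply: lin_kmulr]; lin.
have Bl' : lin (B^~ a : H -> K^o) by case: Bl.
rewrite -[RHS](counitr_lin (g := B^~ a : H -> K^o)) //.
apply: eq_tsum => u q; rewrite [RHS]mulrC.
have -> : counit q = phi (counit q *: 1) by rewrite (linZ _ _ phi_lin) phi1 [RHS]mulr1.
rewrite -antipodel (lin_tsumE _ _ phi_lin).
by rewrite /tsum mulr_sumr.
Qed.

(** The same argument on the other side, with T(x2) x1 collapsing by [coantipodel]. *)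
Lemma left_inv_conv (B : H -> H -> K) x a : bilform B -> left_inv B ->
  tsum (fun x1 x2 => tsum (fun a1 a2 =>
    (phi (S a2 * x1) * B x2 a1 : K^o)) (comul a)) (comul x) = B x a.
Proof.
move=> Bl BL.
transitivity (tsum (fun x1 q => tsum (fun u v =>
    (phi (T u * x1) * B v a : K^o)) (comul q)) (comul x)).
  apply: eq_tsum => x1 q.
  pose g y : K^o := phi (y * x1).
  have gl : lin g by rewrite /g; lin.
  have /(congr1 g) := BL q a.
  rewrite !(lin_tsumE (g := g)) // => e.
  transitivity (tsum (fun a1 a2 => g (B q a1 *: S a2)) (comul a)).
    by apply: eq_tsum => a1 a2; rewrite linZ // [LHS]mulrC.
  by rewrite -e; apply: eq_tsum => u v; rewrite linZ // [RHS]mulrC.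
rewrite -(coassoc (f := fun x1 u v => phi (T u * x1) * B v a : K^o)); last first.
  by split=> ? ?; [apply: lin_kmull|apply: lin_kmull|apply: lin_kmulr]; lin.
have Bl' : lin (B^~ a : H -> K^o) by case: Bl.
rewrite -[RHS](counitl_lin (g := B^~ a : H -> K^o)) //.
apply: eq_tsum => q v.
have -> : counit q = phi (counit q *: 1) by rewrite (linZ _ _ phi_lin) phi1 [RHS]mulr1.
rewrite -coantipodel (lin_tsumE _ _ phi_lin).
by rewrite /tsum [RHS]mulr_suml.
Qed.

End Convolution.

(** The double [circ] is what B x a = h x (circ a) unfolds to for h x y = phi (S (circ y) * x). *)
Lemma integral_form_right_inv phi : integral phi ->
  right_inv (fun x a => phi (S (circ (circ a)) * x)).
Proof.
move=> phiI x a; rewrite circK (integral_right_inv phiI).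
by apply: eq_tsum => ? ?; rewrite circK.
Qed.

Lemma integral_form_left_inv phi : integral phi ->
  left_inv (fun x a => phi (S (circ (circ a)) * x)).
Proof.
move=> phiI x a; rewrite circK (integral_left_inv phiI).
by apply: eq_tsum => ? ?; rewrite circK.
Qed.

(** If B x a = k x (circ a), this represents in the same convention the adjoint form, whose value at
    x, y is the conjugate of k y x. *)
Definition adjoint (B : H -> H -> K) x a := (B (circ a) (circ x))^*.

Lemma adjoint_bilform B : bilform B -> bilform (adjoint B).
Proof.
case=> Bl Br; split=> [a|x] c u v; rewrite /adjoint circD circZ.
  by rewrite (Br _ c^* _ _) rmorphD rmorphM /= conjCK.
by rewrite (Bl _ c^* _ _) rmorphD rmorphM /= conjCK.
Qed.

Lemma adjoint_right_inv B : bilform B -> right_inv B -> right_inv (adjoint B).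
Proof.
move=> Bl BR x a; have := BR (circ a) (circ x).
rewrite tsum_circ; last by apply: blin_balanced; lin.
rewrite [RHS]tsum_circ; last by apply: blin_balanced; lin.
move=> /(congr1 circ); rewrite !circ_tsum => e.
transitivity (tsum (fun x1 x2 =>
   circ (B (circ a) (circ x1) *: circ x2)) (comul x)).
  by apply: eq_tsum => x1 x2; rewrite circZ circK.
rewrite -e; apply: eq_tsum => a1 a2; by rewrite circZ circK.
Qed.

Lemma adjoint_left_inv B : bilform B -> left_inv B -> left_inv (adjoint B).
Proof.
move=> Bl BL x a; have := BL (circ a) (circ x).
rewrite tsum_circ; last by apply: blin_balanced; lin.
rewrite [RHS]tsum_circ; last by apply: blin_balanced; lin.
move=> /(congr1 circ); rewrite !circ_tsum => e.
transitivity (tsum (fun x1 x2 =>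
   circ (B (circ a) (circ x2) *: S (circ x1))) (comul x)).
  by apply: eq_tsum => x1 x2; rewrite circZ.
rewrite -e; apply: eq_tsum => a1 a2.
by rewrite circZ coantipode_circ circK.
Qed.

(* The form and its adjoint are both the unit for the convolution product of
   right and left invariant forms. *)
Lemma integral_form_adjoint phi x a : integral phi ->
  phi (S a * x) = (phi (S (circ x) * circ a))^*.
Proof.
move=> phiI; have phiR := integral_right_inv phiI.
have phiL := integral_left_inv phiI.
have [phil phi1 _ _] := phiI.
pose B x a := phi (S a * x); rewrite -/(B x a).
have Bl : bilform B by rewrite /B; lin.
have B'l := adjoint_bilform Bl.
have B'R := adjoint_right_inv Bl phiR.
have B'L := adjoint_left_inv Bl phiL.
(* The conjugate of the left identity at (circ a, circ x) evaluates to B x a, the right identity at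
   (x, a) to the right-hand side; both are the same double sum once [circ] has swapped the legs. *)
have := left_inv_conv phil phi1 (circ a) (circ x) B'l B'L.
rewrite [RHS]/adjoint !circK => /(congr1 Num.conj); rewrite conjCK => <-.
rewrite -[RHS](right_inv_conv phil phi1 x a B'l B'R).
rewrite tsum_circ; last first.
  apply: blin_balanced; split=> ?; apply: lin_tsum_body => ? ?.
    by apply: lin_kmull; lin.
  by apply: lin_kmulr; lin.
rewrite [RHS]exchange_tsum {1}/tsum rmorph_sum /=; apply: eq_bigr => -[p q] _ /=.
rewrite tsum_circ; last first.
  apply: blin_balanced; split=> ?; first exact: lin_kmulr (B'l.2 _).
  by apply: lin_kmull; lin.
rewrite {1}/tsum rmorph_sum /=; apply: eq_bigr => -[c d] _ /=.
by rewrite rmorphM /= [in X in _ * X]/adjoint conjCK !circK.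
Qed.

End InvariantForms.

(** * Inner products and orthonormal families *)

Section LinearlyClosed.
Variables (K : fieldType) (V : lmodType K).

(** Same body as [subspace], but over any module; the two are convertible on a coalgebra, so proofs
    of one are passed for the other. *)
Definition lin_closed (D : set V) : Prop :=
  D 0 /\ forall (a : K) (u v : V), D u -> D v -> D (a *: u + v).

Lemma lin_closedZ D a u : lin_closed D -> D u -> D (a *: u).
Proof. by case=> D0 Dl Du; rewrite -[_ *: _]addr0; apply: Dl. Qed.
Lemma lin_closedD D u v : lin_closed D -> D u -> D v -> D (u + v).
Proof. by case=> D0 Dl Du Dv; rewrite -[u]scale1r; apply: Dl. Qed.
Lemma lin_closedB D u v : lin_closed D -> D u -> D v -> D (u - v).
Proof. by case=> D0 Dl Du Dv; rewrite addrC -scaleN1r; apply: Dl. Qed.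
Lemma lin_closed_sum D I (r : seq I) F : lin_closed D ->
  (forall i, D (F i)) -> D (\sum_(i <- r) F i).
Proof.
move=> Dl DF; apply: (big_ind D); [by case: Dl| |by []].
by move=> u v; apply: lin_closedD.
Qed.

End LinearlyClosed.

Section HermitianForm.
Variables (K : numClosedFieldType) (V : lmodType K).

Definition hermitian_form (h : V -> V -> K) : Prop :=
  (forall y, linform (h^~ y)) /\ (forall x y, h y x = (h x y)^*).

Variables (h : V -> V -> K) (hH : hermitian_form h).

Lemma hfC x y : h y x = (h x y)^*. Proof. exact: hH.2. Qed.
Lemma hf_lin y : linform (h^~ y). Proof. exact: hH.1. Qed.
Lemma hf0l y : h 0 y = 0. Proof. exact: (lin0 (hf_lin y)). Qed.
Lemma hfDl x x' y : h (x + x') y = h x y + h x' y.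
Proof. exact: (linD _ _ (hf_lin y)). Qed.
Lemma hfBl x x' y : h (x - x') y = h x y - h x' y.
Proof. exact: (linB _ _ (hf_lin y)). Qed.
Lemma hfZl a x y : h (a *: x) y = a * h x y.
Proof. exact: (linZ _ _ (hf_lin y)). Qed.
Lemma hf_suml I (r : seq I) F y :
  h (\sum_(i <- r) F i) y = \sum_(i <- r) h (F i) y.
Proof. exact: (lin_sum _ _ _ (hf_lin y)). Qed.
Lemma hf0r y : h y 0 = 0. Proof. by rewrite hfC hf0l rmorph0. Qed.
Lemma hfDr x x' y : h y (x + x') = h y x + h y x'.
Proof. by rewrite hfC hfDl rmorphD /= -!hfC. Qed.
Lemma hfZr a x y : h x (a *: y) = a^* * h x y.
Proof. by rewrite hfC hfZl rmorphM /= -hfC. Qed.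
Lemma hfBr x x' y : h y (x - x') = h y x - h y x'.
Proof. by rewrite hfC hfBl rmorphB /= -!hfC. Qed.
Lemma hf_sumr I (r : seq I) F y :
  h y (\sum_(i <- r) F i) = \sum_(i <- r) h y (F i).
Proof.
by rewrite hfC hf_suml rmorph_sum; apply: eq_bigr => i _; rewrite /= -hfC.
Qed.

(** A scalar leaves either factor conjugated and re-enters the other one conjugated, so these
    conjugate linear bodies are legitimate in Sweedler sums. *)
Lemma balanced_antilin (W U : lmodType K) x (f : W -> U) :
  (forall u v, f (u + v) = f u + f v) -> (forall a u, f (a *: u) = a^* *: f u) ->
  balanced (fun u v => h x u *: f v) /\ balanced (fun u v => h x v *: f u).
Proof.
move=> fD fZ; have f0 : f 0 = 0 by rewrite -(scale0r 0) fZ conjC0 !scale0r.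
split; split=> [v v' w|v w w'|w|a v w].
- by rewrite hfDr scalerDl.
- by rewrite fD scalerDr.
- by rewrite hf0r scale0r.
- by rewrite hfZr fZ scalerA mulrC.
- by rewrite fD scalerDr.
- by rewrite hfDr scalerDl.
- by rewrite f0 scaler0.
- by rewrite hfZr fZ scalerA mulrC.
Qed.

End HermitianForm.

Section InnerProduct.
Variables (K : numClosedFieldType) (V : lmodType K).

Definition inner_product (ip : V -> V -> K) : Prop :=
  hermitian_form ip /\ forall x, x != 0 -> 0 < ip x x.

Lemma inner_product_dot (ip : {dot V for Num.conj}) : inner_product ip.
Proof.
split=> [|x x0]; first split=> [y a u v|x y].
- by rewrite linearPl.
- by rewrite (hermC ip y x) expr0 mul1r.
- exact: neq0_dnorm_gt0.
Qed.

Variables (ip : V -> V -> K) (ipP : inner_product ip).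
Let ipH : hermitian_form ip := ipP.1.
Let ipC := hfC ipH.
Let ipBl := hfBl ipH.
Let ipZl := hfZl ipH.
Let ipDl := hfDl ipH.
Let ipZr := hfZr ipH.
Let ip_suml := hf_suml ipH.

Lemma ip_gt0 x : x != 0 -> 0 < ip x x. Proof. exact: ipP.2. Qed.
Lemma ip_eq0 x : ip x x = 0 -> x = 0.
Proof. by move=> x0; apply/eqP/negPn/negP => /ip_gt0; rewrite x0 ltxx. Qed.
Lemma ip_ge0 x : 0 <= ip x x.
Proof. by have [->|/ip_gt0/ltW//] := eqVneq x 0; rewrite (hf0l ipH). Qed.

(** The family is indexed by [nat] and read only below [n], so that it can be lengthened without a
    change of type. *)
Definition onfam n (e : nat -> V) : Prop :=
  forall i j : 'I_n, ip (e i) (e j) = (i == j)%:R.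

(** The equation [proj n e v = v] serves below as membership in the span of the family. *)
Definition proj n (e : nat -> V) (v : V) : V := \sum_(i < n) ip v (e i) *: e i.

Lemma proj_lin n e : lin (proj n e).
Proof.
move=> a u v; rewrite /proj scaler_sumr -big_split /=; apply: eq_bigr => i _.
by rewrite ipDl ipZl scalerDl scalerA.
Qed.

Lemma ip_proj n e v (i : 'I_n) : onfam n e -> ip (proj n e v) (e i) = ip v (e i).
Proof.
move=> eo; rewrite ip_suml (bigD1 i) //= ipZl eo eqxx mulr1 big1 ?addr0 //.
by move=> j ji; rewrite ipZl eo (negPf ji) mulr0.
Qed.

Lemma proj_fam n e (i : 'I_n) : onfam n e -> proj n e (e i) = e i.
Proof.
move=> eo; rewrite /proj (bigD1 i) //= eo eqxx scale1r big1 ?addr0 //.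
by move=> j ji; rewrite eo eq_sym (negPf ji) scale0r.
Qed.

Lemma proj_in (D : set V) n (e : nat -> V) v : lin_closed D -> (forall i : 'I_n, D (e i)) ->
  D (proj n e v).
Proof. by move=> Dl De; apply: lin_closed_sum => // i; apply: lin_closedZ. Qed.

(** One Gram-Schmidt step: the normalised residue of [v] is appended. The last clause keeps the new
    family inside any subspace that contains [v] and the old family. *)
Lemma onfam_extend n e v : onfam n e -> proj n e v <> v ->
  exists e', [/\ onfam n.+1 e', proj n.+1 e' v = v,
      forall w, proj n e w = w -> proj n.+1 e' w = w
    & forall D : set V, lin_closed D -> D v -> (forall i : 'I_n, D (e i)) ->
      forall i : 'I_n.+1, D (e' i)].
Proof.
move=> eo /eqP pv; pose r := v - proj n e v.
pose e' (i : nat) := if i == n then (sqrtC (ip r r))^-1 *: r else e i.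
have r0 : r != 0 by rewrite subr_eq0 eq_sym.
have rr0 := ip_gt0 r0.
pose c := (sqrtC (ip r r))^-1.
have creal : c^* = c.
  by rewrite /c fmorphV; congr (_^-1); apply/CrealP/ger0_real; rewrite sqrtC_ge0 ltW.
have cc : c * (c * ip r r) = 1.
  rewrite mulrA -expr2 exprVn sqrtCK mulVf // gt_eqF //.
have e'n : e' n = c *: r by rewrite /e' eqxx.
have e'lt (i : 'I_n) : e' i = e i by rewrite /e' ltn_eqF.
have re (i : 'I_n) : ip r (e i) = 0 by rewrite ipBl ip_proj // subrr.
have eo' : onfam n.+1 e'.
  move=> i j; case: (unliftP ord_max i) => [i' ->|->];
    case: (unliftP ord_max j) => [j' ->|->]; rewrite ?lift_max /= ?e'n ?e'lt.
  - by rewrite eo (inj_eq lift_inj).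
  - rewrite ipZr [ip (e _) r]ipC re conjC0 mulr0.
    by rewrite eq_sym (negPf (neq_lift _ _)).
  - rewrite ipZl re mulr0.
    by rewrite (negPf (neq_lift _ _)).
  - by rewrite ipZl ipZr creal cc eqxx.
have p' w : proj n.+1 e' w = proj n e w + ip w (c *: r) *: (c *: r).
  rewrite /proj big_ord_recr /= e'n; congr (_ + _).
  by apply: eq_bigr => i _; rewrite /= e'lt.
have pr w : proj n e w = w -> ip w r = 0.
  move=> <-; rewrite /proj ip_suml big1 // => i _.
  by rewrite ipZl [ip (e _) r]ipC re conjC0 mulr0.
exists e'; split=> // [|w pw|D Dl Dv De i]; last 2 first.
- by rewrite p' pw ipZr (pr w) // mulr0 scale0r addr0.
- case: (unliftP ord_max i) => [j ->|->]; first by rewrite lift_max e'lt.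
  by rewrite e'n; apply: lin_closedZ => //; apply: lin_closedB => //; apply: proj_in.
rewrite p' ipZr creal scalerA.
have -> : ip v r = ip r r.
  rewrite [in RHS]/r ipBl (pr (proj n e v)) ?subr0 //.
  rewrite {2}/proj (lin_sum _ _ _ (proj_lin n e)); apply: eq_bigr => i _.
  by rewrite (linZ _ _ (proj_lin n e)) proj_fam.
by rewrite mulrAC -mulrA cc scale1r addrC subrK.
Qed.

Lemma gram_schmidt (D : set V) (s : seq V) : lin_closed D ->
  (forall v, v \in s -> D v) ->
  exists n e, [/\ onfam n e, forall i : 'I_n, D (e i)
                & forall v, v \in s -> proj n e v = v].
Proof.
move=> Dl; elim: s => [_|v s IHs Ds].
  by exists 0, (fun=> 0); split=> [[]|[]|].
have [|n [e [eo De es]]] := IHs; first by move=> w ws; apply: Ds; rewrite inE ws orbT.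
have Dv : D v by apply: Ds; rewrite inE eqxx.
have [pv|/(onfam_extend eo)] := pselect (proj n e v = v).
  by exists n, e; split=> // w; rewrite inE => /orP[/eqP->|/es].
case=> e' [eo' pv pw De']; exists n.+1, e'; split=> // [i|w]; first exact: De'.
by rewrite inE => /orP[/eqP->//|/es/pw].
Qed.

(** The coordinates of [f] along [e] form an m by n matrix with orthonormal rows, hence of rank
    m. *)
Lemma onfam_bound n (e : nat -> V) m (f : nat -> V) : onfam n e -> onfam m f ->
  (forall i : 'I_m, proj n e (f i) = f i) -> (m <= n)%N.
Proof.
move=> eo fo fe; pose M : 'M[K]_(m, n) := \matrix_(i, j) ip (f i) (e j).
suff /mxrank_unitary <- : M \is unitarymx by exact: rank_leq_col.
apply/unitarymxP/matrixP => i j; rewrite !mxE -fo -[f i in RHS]fe ip_suml.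
by apply: eq_bigr => k _; rewrite !mxE ipZl (ipC (f j)).
Qed.

(** In a space of possibly infinite dimension, a bound on the dimension of a subspace is expressed
    through its orthonormal families. *)
Definition dim_le (D : set V) N : Prop :=
  forall n e, onfam n e -> (forall i : 'I_n, D (e i)) -> (n <= N)%N.

Lemma dim_le_basis (D : set V) N : lin_closed D -> dim_le D N ->
  exists n e, [/\ onfam n e, forall i : 'I_n, D (e i)
                & forall v, D v -> proj n e v = v].
Proof.
move=> Dl DN.
pose P n := `[< exists e, onfam n e /\ forall i : 'I_n, D (e i) >].
have exP : exists n, P n by exists 0; apply/asboolP; exists (fun=> 0); split=> -[].
have ubP n : P n -> (n <= N)%N by move=> /asboolP[e [eo De]]; apply: DN eo De.
case: (ex_maxnP exP ubP) => n /asboolP[e [eo De]] nmax.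
exists n, e; split=> // v Dv; apply: contrapT => /(onfam_extend eo)[e' [eo' _ _ De']].
suff /nmax : P n.+1 by rewrite ltnn.
by apply/asboolP; exists e'; split=> //; apply: De'.
Qed.

End InnerProduct.

(** * Expansion of tensors and finite-dimensional coideals *)

Section TensorExpansion.
Variables (K : numClosedFieldType) (V W : lmodType K).

Lemma tensor_expandl (ip : V -> V -> K) n e (s : seq (V * W)) :
  inner_product ip -> onfam ip n e ->
  (forall p, p \in s -> proj ip n e p.1 = p.1) ->
  let t := \sum_(p <- s) (p.1 ⊗ p.2) in
  t = \sum_(i < n) (e i ⊗ tsum (fun u v => ip u (e i) *: v) t).
Proof.
move=> ipP eo es /=.
have ipl y : linform (ip^~ y) := ipP.1.1 y.
under [RHS]eq_bigr => i _.
  have b : blin (fun u v => ip u (e i) *: v : W).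
    by have := ipl (e i) => ?; lin.
  rewrite (tsumE _ (blin_balanced b)).
  rewrite (lin_sum _ _ _ (lin_purer _ (@lin_id _ _))).
  over.
rewrite exchange_big /= big_seq [RHS]big_seq; apply: eq_bigr => p ps.
rewrite -{1}(es _ ps) (lin_sum _ _ _ (lin_purel _ (@lin_id _ _))).
by apply: eq_bigr => i _; rewrite pureZl pureZr.
Qed.

Lemma tensor_expandr (ip : W -> W -> K) n e (s : seq (V * W)) :
  inner_product ip -> onfam ip n e ->
  (forall p, p \in s -> proj ip n e p.2 = p.2) ->
  let t := \sum_(p <- s) (p.1 ⊗ p.2) in
  t = \sum_(i < n) (tsum (fun u v => ip v (e i) *: u) t ⊗ e i).
Proof.
move=> ipP eo es /=.
have ipl y : linform (ip^~ y) := ipP.1.1 y.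
under [RHS]eq_bigr => i _.
  have b : blin (fun u v => ip v (e i) *: u : V).
    by have := ipl (e i) => ?; lin.
  rewrite (tsumE _ (blin_balanced b)).
  rewrite (lin_sum _ _ _ (lin_purel _ (@lin_id _ _))).
  over.
rewrite exchange_big /= big_seq [RHS]big_seq; apply: eq_bigr => p ps.
rewrite -{1}(es _ ps) (lin_sum _ _ _ (lin_purer _ (@lin_id _ _))).
by apply: eq_bigr => i _; rewrite pureZl pureZr.
Qed.

End TensorExpansion.

Section FiniteCoideal.
Variables (K : numClosedFieldType) (C : coalgType K).
Variables (ip : C -> C -> K) (ipP : inner_product ip).

(** Contraction of the left leg of [comul x] with [y]. On an orthonormal basis of a right coideal
    these are its matrix coefficients. *)
Definition coef (y x : C) : C := tsum (fun u v => ip u y *: v) (comul x).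

Lemma coef_lin y : lin (coef y).
Proof. by have := ipP.1.1 y => ?; rewrite /coef; lin. Qed.

(** Write [comul x] as the sum of a i ⊗ f i with orthonormal f. By coassociativity the span of the a
    i is a right coideal, and by the counit it contains [x]; Gram-Schmidt then gives [e]. *)
Lemma finite_coideal x : exists n e, [/\ onfam ip n e, proj ip n e x = x
  & forall y, proj ip n e y = y -> comul y = \sum_(i < n) (e i ⊗ coef (e i) y)].
Proof.
have ipl y : linform (ip^~ y) := ipP.1.1 y.
have setTl : lin_closed (@setT C) by [].
have [m [f [fo _ fx]]] := gram_schmidt ipP (s := [seq p.2 | p <- repr (comul x)])
  setTl (fun _ _ => I).
pose a i := tsum (fun u v => ip v (f i) *: u) (comul x).
have xE : comul x = \sum_(i < m) (a i ⊗ f i).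
  rewrite {1}[comul x]tensor_repr.
  rewrite (tensor_expandr ipP fo); last by move=> p ps; apply: fx; apply: map_f.
  by apply: eq_bigr => i _; rewrite -tensor_repr.
pose g j q := tsum (fun d v => ip v (f j) *: d) (comul q).
have gl j : lin (g j) by have := ipl (f j) => ?; rewrite /g; lin.
(* Contracting the last leg of the twice iterated coproduct of x with f j gives comul (a j);
   regrouped, it is the sum of c ⊗ g j q over the legs c, q of comul x. *)
have comula j : comul (a j) = \sum_(i < m) (a i ⊗ g j (f i)).
  have := ipl (f j) => flj.
  rewrite /a (lin_tsumE (g := comul)); last by lin.
  transitivity (tsum (fun u v => tsum (fun c d =>
      ip v (f j) *: (c ⊗ d)) (comul u)) (comul x)).
    apply: eq_tsum => u v; rewrite linearZ /= [comul u in LHS]tensor_repr.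
    by rewrite scaler_sumr.
  rewrite (coassoc (f := fun c d v => ip v (f j) *: (c ⊗ d))); last by lin.
  transitivity (tsum (fun c q => c ⊗ g j q) (comul x)).
    apply: eq_tsum => c q; rewrite /g (lin_tsumE (g := fun z => c ⊗ z)); last by lin.
    by apply: eq_tsum => d v; rewrite pureZr.
  have bg : blin (fun c q : C => c ⊗ g j q) by have := gl j => ?; lin.
  rewrite [in LHS]xE (lin_sum _ _ _ (lin_tsum bg (@lin_id _ _))).
  by apply: eq_bigr => i _; rewrite tsum_blin_pure.
pose V0 := [set y | exists l : nat -> K, y = \sum_(i < m) l i *: a i].
have V0l : lin_closed V0.
  split; first by exists (fun=> 0); rewrite big1 // => i _; rewrite scale0r.
  move=> c u v [l ->] [l' ->]; exists (fun i => c * l i + l' i).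
  rewrite scaler_sumr -big_split /=; apply: eq_bigr => i _.
  by rewrite scalerDl scalerA.
have aV0 (j : 'I_m) : V0 (a j).
  exists (fun i : nat => (i == j :> nat)%:R); rewrite (bigD1 j) //= eqxx scale1r big1 ?addr0 //.
  by move=> i ij; rewrite (inj_eq val_inj) (negPf ij) scale0r.
have xV0 : V0 x.
  exists (fun i => counit (f i)); rewrite -[LHS]counitr xE.
  have bc : blin (fun c d : C => counit d *: c) by lin.
  rewrite (lin_sum _ _ _ (lin_tsum bc (@lin_id _ _))).
  by apply: eq_bigr => i _; rewrite tsum_blin_pure.
have aS v : v \in [seq a (i : 'I_m) | i <- enum 'I_m] -> V0 v.
  by case/mapP => i _ ->.
have [n [e [eo eV0 ea]]] := gram_schmidt ipP V0l aS.
have ea' (i : 'I_m) : proj ip n e (a i) = a i.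
  by apply: ea; apply: map_f; rewrite mem_enum.
have pl := proj_lin ipP n e.
exists n, e; split=> // [|y yp].
  have [l ->] := xV0; rewrite (lin_sum _ _ _ pl); apply: eq_bigr => i _.
  by rewrite (linZ _ _ pl) ea'.
have [l yE] : V0 y by rewrite -yp; apply: proj_in.
pose w i := \sum_(j < m) l j *: g j (f i).
have cE : comul y = \sum_(p <- [seq (a i, w i) | i : 'I_m <- enum 'I_m]) (p.1 ⊗ p.2).
  rewrite big_map big_enum /= yE linear_sum /=.
  under eq_bigr do rewrite linearZ /= comula scaler_sumr.
  rewrite exchange_big /=; apply: eq_bigr => i _.
  rewrite /w (lin_sum _ _ _ (lin_purer _ (@lin_id _ _))); apply: eq_bigr => j _.
  by rewrite pureZr.
rewrite {1}cE (tensor_expandl ipP eo); first by rewrite -cE.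
by move=> p /mapP[i _ ->] /=.
Qed.

End FiniteCoideal.

(** * Positivity *)

(** Spectral theorem for the Gram matrix [A] of [h] in the family [e]: the rows of the unitary
    matrix [P] are the coordinates of the eigenvectors. *)
Lemma simultaneous_diagonalization (K : numClosedFieldType) (V : lmodType K)
    (ip h : V -> V -> K) n e :
  inner_product ip -> hermitian_form h -> onfam ip n e ->
  exists (f : nat -> V) (d : nat -> K),
    [/\ forall k : 'I_n, proj ip n e (f k) = f k,
        onfam ip n f,
        forall v, proj ip n e v = v -> proj ip n f v = v
      & forall (k : 'I_n) v, proj ip n e v = v -> h (f k) v = d k * ip (f k) v].
Proof.
move=> ipP hH eo.
have ipH := ipP.1.
pose A : 'M[K]_n := \matrix_(i, j) h (e i) (e j).
have /hermitian_normalmx/orthomx_spectralP AE : A \is hermsymmx.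
  apply/is_hermitianmxP/matrixP => i j.
  by rewrite expr0 scale1r !mxE (hfC hH).
pose P := spectralmx A; pose dg := spectral_diag A.
have PU : P \is unitarymx by exact: spectral_unitarymx.
have PA : P *m A = diag_mx dg *m P.
  by rewrite {1}AE -/P -/dg !mulmxA mulmxV ?mul1mx // spectral_unit.
have PP (k l : 'I_n) : \sum_j P k j * (P l j)^* = (k == l)%:R.
  have /unitarymxP/matrixP/(_ k l) := PU; rewrite !mxE => <-.
  by apply: eq_bigr => j _; rewrite !mxE.
have PP' (i j : 'I_n) : \sum_k (P k i)^* * P k j = (i == j)%:R.
  have : P^t* *m P = 1%:M by rewrite -invmx_unitary // mulVmx // spectral_unit.
  move/matrixP/(_ i j); rewrite !mxE => <-.
  by apply: eq_bigr => k _; rewrite !mxE.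
pose fo (k : 'I_n) := \sum_(i < n) P k i *: e i.
(* The value 0 is a filler for the indices from [n] on. *)
pose f k := if insub k is Some k' then fo k' else 0.
pose d k := if insub k is Some k' then dg 0 k' else 0.
have fE (k : 'I_n) : f k = fo k by rewrite /f valK.
have dE (k : 'I_n) : d k = dg 0 k by rewrite /d valK.
have pl := proj_lin ipP n e.
have fe (k j : 'I_n) : ip (fo k) (e j) = P k j.
  rewrite (hf_suml ipH) (bigD1 j) //= (hfZl ipH) eo eqxx mulr1 big1 ?addr0 //.
  by move=> i ij; rewrite (hfZl ipH) eo (negPf ij) mulr0.
have hfe (k j : 'I_n) : h (fo k) (e j) = dg 0 k * P k j.
  rewrite (hf_suml hH); have /matrixP/(_ k j) := PA; rewrite mul_diag_mx !mxE => <-.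
  by apply: eq_bigr => i _; rewrite (hfZl hH) mxE.
have ipf v (k : 'I_n) : ip v (fo k) = \sum_(j < n) ip v (e j) * (P k j)^*.
  by rewrite (hf_sumr ipH); apply: eq_bigr => j _; rewrite (hfZr ipH) mulrC.
exists f, d; split=> [k|k l|v vp|k v vp].
- rewrite fE (lin_sum _ _ _ pl); apply: eq_bigr => i _.
  by rewrite (linZ _ _ pl) proj_fam.
- by rewrite !fE ipf -PP; apply: eq_bigr => j _; rewrite fe.
(* Completeness rests on the orthonormal columns of [P] ([PP']), as orthonormality rested on its
   rows ([PP]). *)
- rewrite -[RHS]vp /proj.
  under eq_bigr do rewrite fE ipf scaler_suml.
  under eq_bigr => k _ do under eq_bigr => j _ do rewrite scaler_sumr.
  rewrite exchange_big /=; apply: eq_bigr => j _; rewrite exchange_big /=.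
  transitivity (\sum_(i < n) (ip v (e j) * (j == i)%:R) *: e i).
    apply: eq_bigr => i _; rewrite -PP' mulr_sumr scaler_suml.
    by apply: eq_bigr => k _; rewrite scalerA mulrA.
  rewrite (bigD1 j) //= eqxx mulr1 big1 ?addr0 // => i ij.
  by rewrite eq_sym (negPf ij) mulr0 scale0r.
- rewrite fE dE -vp (hf_sumr hH) (hf_sumr ipH) mulr_sumr.
  by apply: eq_bigr => j _; rewrite (hfZr hH) (hfZr ipH) hfe fe mulrCA.
Qed.

Section Positivity.
Variables (K : numClosedFieldType) (H : circHopfAlgType K).
Local Notation S := (antipode : {linear H -> H}).
Variables (phi : H -> K) (phiI : integral phi).
Variables (ip1 ip2 : H -> H -> K).
Hypotheses (ip1P : inner_product ip1) (ip2P : inner_product ip2).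
Hypothesis ip1R : right_inv (fun x a => ip1 x (circ a)).
Hypothesis ip2L : left_inv (fun x a => ip2 x (circ a)).

Let h x y := phi (S (circ y) * x).

Let phil : linform phi. Proof. by case: phiI. Qed.

Lemma integral_hermitian_form : hermitian_form h.
Proof.
split=> [y|x y]; first by rewrite /h; lin.
by rewrite /h [LHS](integral_form_adjoint _ _ phiI) circK.
Qed.
Let hH := integral_hermitian_form.

Lemma circ_bilform (k : H -> H -> K) :
  hermitian_form k -> bilform (fun x a => k x (circ a)).
Proof.
move=> kH; split=> [a|x] c u v; first exact: (kH.1 _).
by rewrite circD circZ (hfDr kH) (hfZr kH) conjCK.
Qed.

Lemma right_invE (k : H -> H -> K) : hermitian_form k ->
  right_inv (fun x a => k x (circ a)) ->
  forall x y, tsum (fun x1 x2 => k x1 y *: x2) (comul x) =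
              tsum (fun y1 y2 => k x y1 *: circ y2) (comul y).
Proof.
move=> kH kR x y; have := kR x (circ y); rewrite circK => ->.
have klx : linform (fun a => k x (circ a)) := (circ_bilform kH).2 x.
rewrite tsum_circ; last by apply: blin_balanced; lin.
by apply: eq_tsum => a b; rewrite circK.
Qed.

Let hR : right_inv (fun x a => h x (circ a)) := integral_form_right_inv phiI.

(* If h = mu ip1 on a finite-dimensional right coideal containing a, then
   ip2 a a = mu * sum_i ip2 c_i c_i where comul a = sum_i e_i ⊗ c_i. *)
Lemma integral_eigenvalue_gt0 n e mu a : onfam ip1 n e ->
  (forall y, proj ip1 n e y = y ->
    comul y = \sum_(i < n) (e i ⊗ coef ip1 (e i) y)) ->
  proj ip1 n e a = a -> a != 0 ->
  (forall v, proj ip1 n e v = v -> h a v = mu * ip1 a v) ->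
  0 < mu.
Proof.
move=> eo ce ap a0 ha.
pose c i := coef ip1 (e i) a.
(* By right invariance ([expand]) the sum becomes one in the values of h a, where h is mu times ip1.
   Going back by the invariance of ip1 leaves mu c j, because [e] is orthonormal. *)
have hc (j : 'I_n) : \sum_(i < n) h (e i) (e j) *: c i = mu *: c j.
  have ej : proj ip1 n e (e j) = e j by apply: proj_fam.
  have expand k : hermitian_form k -> right_inv (fun x b => k x (circ b)) ->
      \sum_(i < n) k (e i) (e j) *: c i =
      \sum_(i < n) k a (e i) *: circ (coef ip1 (e i) (e j)).
    move=> kH kR; have := right_invE kH kR a (e j).
    have kl := kH.1 (e j).
    have bk : blin (fun x1 x2 : H => k x1 (e j) *: x2) by lin.
    rewrite !ce // tsum_sum; last exact: blin_balanced.
    by rewrite tsum_sum; last exact: (balanced_antilin kH a (@circD _ H) (@circZ _ H)).1.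
  rewrite (expand _ hH hR).
  under eq_bigr => i _ do rewrite ha ?proj_fam // -scalerA.
  rewrite -scaler_sumr -(expand _ ip1P.1 ip1R) (bigD1 j) //= eo eqxx scale1r.
  by rewrite big1 ?addr0 // => i ij; rewrite eo (negPf ij) scale0r.
have cE : comul a = \sum_(i < n) (e i ⊗ c i) by apply: ce.
(* [left_inv_conv] for ip2 expands ip2 a a as the sum of h (e i) (e j) ip2 (c i) (c j), and [hc]
   carries out the sum over i. *)
have key : mu * (\sum_(j < n) ip2 (c j) (c j)) = ip2 a a.
  have ip2b := circ_bilform ip2P.1.
  have [_ phi1 _ _] := phiI.
  have := left_inv_conv phil phi1 a (circ a) ip2b ip2L; rewrite circK => <-.
  transitivity (\sum_(i < n) \sum_(j < n) h (e i) (e j) * ip2 (c i) (c j)).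
    rewrite exchange_big mulr_sumr; apply: eq_bigr => j _ /=.
    rewrite -(hfZl ip2P.1) -hc (hf_suml ip2P.1); apply: eq_bigr => i _.
    by rewrite (hfZl ip2P.1).
  have bl (x y : H) : bilform (fun a1 a2 : H => phi (S a2 * x) * ip2 y (circ a1)).
    split=> ?; [apply: lin_kmulr (ip2b.2 _)|apply: lin_kmull; lin].
  have bl' : bilform (fun x1 x2 : H => tsum (fun a1 a2 : H =>
      phi (S a2 * x1) * ip2 x2 (circ a1)) (comul (circ a))).
    split=> ?; apply: lin_tsum_body => ? ?; first by apply: lin_kmull; lin.
    exact: lin_kmulr (ip2b.1 _).
  rewrite [in RHS]cE tsum_sum; last exact: blin_balanced bl'.
  apply: eq_bigr => i _; rewrite tsum_circ; last exact: blin_balanced (bl _ _).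
  under eq_tsum => u v do rewrite circK -/(h (e i) u).
  rewrite cE tsum_sum //; split=> [v v' w|v w w'|w|b v w].
  - by rewrite (hfDr hH) mulrDl.
  - by rewrite (hfDr ip2P.1) mulrDr.
  - by rewrite (hf0r hH) mul0r.
  - by rewrite (hfZr hH) (hfZr ip2P.1) mulrCA mulrA.
have s0 : 0 <= \sum_(j < n) ip2 (c j) (c j) by apply: sumr_ge0 => j _; exact: ip_ge0.
have := ip_gt0 ip2P a0; rewrite -key.
move: s0; rewrite le_eqVlt => /orP[/eqP <-|s0]; first by rewrite mulr0 ltxx.
by rewrite pmulr_lgt0.
Qed.

(** In an eigenbasis of the coideal of [x], h x x is the sum of the d k |ip1 x (f k)|^2, with every
    d k positive. *)
Lemma integral_inner_product : inner_product h.
Proof.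
split=> // x x0; have [n [e [eo ex ce]]] := finite_coideal ip1P x.
have [f [d [fe fo ef hd]]] := simultaneous_diagonalization ip1P hH eo.
have d0 (k : 'I_n) : 0 < d k.
  apply: (integral_eigenvalue_gt0 eo ce (fe k)) => [|v /hd->//].
  apply/eqP => fk0; have := fo k k; rewrite fk0 (hf0l ip1P.1) eqxx => /eqP.
  by rewrite eq_sym oner_eq0.
have hx : h x x = \sum_(k < n) d k * (ip1 x (f k) * (ip1 x (f k))^*).
  rewrite -{1}(ef x ex) (hf_suml hH); apply: eq_bigr => k _.
  by rewrite (hfZl hH) hd // (hfC ip1P.1 x (f k)) mulrCA.
have t0 (k : 'I_n) : 0 <= d k * (ip1 x (f k) * (ip1 x (f k))^*).
  by rewrite mulr_ge0 ?mul_conjC_ge0 // ltW.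
rewrite lt_def hx sumr_ge0 // andbT; apply: contraNneq x0 => /psumr_eq0P-/(_ _ _ isT) s0.
rewrite -(ef x ex) /proj big1 // => k _.
have /eqP := s0 (fun k _ => t0 k) k.
by rewrite mulf_eq0 mul_conjC_eq0 gt_eqF //= => /eqP->; rewrite scale0r.
Qed.

End Positivity.

(** * Orthogonal decomposition into simple subcoalgebras *)

Section SumOf.
Variables (K : fieldType) (C : coalgType K).
Implicit Types (P : set (set C)) (D : set C).

Lemma sum_of0 P : sum_of P 0.
Proof.
by exists 0, (fun=> set0), (fun=> 0); split=> [[]//|]; rewrite big_ord0.
Qed.

Lemma sum_of_mem P D d : P D -> D d -> sum_of P d.
Proof.
by move=> PD Dd; exists 1, (fun=> D), (fun=> d); split=> //; rewrite big_ord1.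
Qed.

Lemma sum_ofD P x y : sum_of P x -> sum_of P y -> sum_of P (x + y).
Proof.
case=> [n [D [d [Dd ->]]]] [m [E [e [Ee ->]]]].
exists (n + m),
  (fun i => match fintype.split i with inl i => D i | inr j => E j end),
  (fun i => match fintype.split i with inl i => d i | inr j => e j end); split.
  by move=> i; case: fintype.split => j.
rewrite big_split_ord /=; congr (_ + _); apply: eq_bigr => i _.
  by rewrite (unsplitK (inl i)).
by rewrite (unsplitK (inr i)).
Qed.

Lemma sum_of_ind P (Q : C -> Prop) : Q 0 -> (forall u v, Q u -> Q v -> Q (u + v)) ->
  (forall D d, P D -> D d -> Q d) -> forall x, sum_of P x -> Q x.
Proof.
move=> Q0 QD QP x [n [D [d [Dd ->]]]]; apply: big_ind => // i _.
by have [] := Dd i; apply: QP.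
Qed.

End SumOf.

Section Subcoalgebra.
Variables (K : fieldType) (C : coalgType K).

(** The representative of [comul c] behind [tsum] may have legs outside [D]; balancedness allows
    replacing it by one with legs in [D]. *)
Lemma subcoalgebra_tsum (U : lmodType K) (D : set C) (E : set U) (f : C -> C -> U) c :
  subcoalgebra D -> D c -> lin_closed E -> balanced f ->
  (forall u v, D u -> D v -> E (f u v)) -> E (tsum f (comul c)).
Proof.
case=> _ DD Dc El fb Ef; have [s sD ->] := DD c Dc.
rewrite tsumE // big_seq; apply: big_ind; first by case: El.
  by move=> u v; apply: lin_closedD.
by move=> p /sD[? ?]; apply: Ef.
Qed.

End Subcoalgebra.

Section InvariantInnerProduct.
Variables (K : numClosedFieldType) (H : circHopfAlgType K).
Local Notation S := (antipode : {linear H -> H}).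
Local Notation T := (@coantipode K H : {linear H -> H}).
Variables (h : H -> H -> K) (hP : inner_product h).
Hypothesis hR : right_inv (fun x a => h x (circ a)).
Hypothesis hL : left_inv (fun x a => h x (circ a)).
Hypothesis antipode_inj : forall x : H, S x = 0 -> x = 0.

Let hH : hermitian_form h := hP.1.
Let hl y : linform (h^~ y) := hH.1 y.

Let rslice (y x : H) : H := tsum (fun u v => h v y *: u) (comul x).

(** Expanding the left legs of [comul c] makes the right legs slices, hence elements of [D].
    Expanding these along an orthonormal family of [D] makes the left legs slices as well. *)
Lemma slices_subcoalgebra (D : set H) : lin_closed D ->
  (forall c y, D c -> D (coef h y c)) -> (forall c y, D c -> D (rslice y c)) ->
  subcoalgebra D.
Proof.
move=> Dl Dc Dr; split=> // c cD.
have setTl : lin_closed (@setT H) by [].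
have [n [e [eo _ ee]]] := gram_schmidt hP (s := [seq p.1 | p <- repr (comul c)])
  setTl (fun _ _ => I).
have cE : comul c = \sum_(p <- [seq (e (i : 'I_n), coef h (e i) c) | i <- enum 'I_n])
    (p.1 ⊗ p.2).
  rewrite big_map big_enum /= {1}[comul c]tensor_repr.
  rewrite (tensor_expandl hP eo); last by move=> p ps; apply: ee; apply: map_f.
  by apply: eq_bigr => i _; rewrite -tensor_repr.
have [|m [f [fo fD ff]]] := gram_schmidt hP
    (s := [seq coef h (e (i : 'I_n)) c | i <- enum 'I_n]) Dl.
  by move=> _ /mapP[i _ ->]; apply: Dc.
exists [seq (rslice (f (i : 'I_m)) c, f i) | i <- enum 'I_m].
  by move=> _ /mapP[i _ ->]; split; [apply: Dr|apply: fD].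
rewrite big_map big_enum /= {1}cE (tensor_expandr hP fo); last first.
  by move=> p /mapP[i ii ->]; apply: ff; apply: map_f.
by apply: eq_bigr => i _; rewrite -cE.
Qed.

Lemma subcoalgebra_coef (D : set H) c y : subcoalgebra D -> D c -> D (coef h y c).
Proof.
move=> DC Dc; apply: (subcoalgebra_tsum DC Dc DC.1) => [|u v _ Dv].
  by apply: blin_balanced; have := hl y => ?; lin.
exact: (lin_closedZ _ DC.1).
Qed.

Lemma subcoalgebra_rslice (D : set H) c y : subcoalgebra D -> D c -> D (rslice y c).
Proof.
move=> DC Dc; apply: (subcoalgebra_tsum DC Dc DC.1) => [|u v Du _].
  by apply: blin_balanced; have := hl y => ?; lin.
exact: (lin_closedZ _ DC.1).
Qed.

Lemma subcoalgebraI (D E : set H) :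
  subcoalgebra D -> subcoalgebra E -> subcoalgebra (D `&` E).
Proof.
move=> DC EC; apply: slices_subcoalgebra => [|c y [Dc Ec]|c y [Dc Ec]].
- split; first by split; [case: DC.1|case: EC.1].
  by move=> a u v [Du Eu] [Dv Ev]; split; [apply: DC.1.2|apply: EC.1.2].
- by split; apply: subcoalgebra_coef.
- by split; apply: subcoalgebra_rslice.
Qed.

Let set0l : lin_closed [set 0 : H].
Proof. by split=> // a u v /= -> ->; rewrite scaler0 addr0. Qed.

Lemma coef_circ x y :
  coef h y x = tsum (fun y1 y2 => h x y1 *: circ y2) (comul y).
Proof. by rewrite /coef (right_invE hH hR). Qed.

Lemma left_invE x y : tsum (fun x1 x2 => h x2 y *: T x1) (comul x) =
  tsum (fun y1 y2 => h x y2 *: S (circ y1)) (comul y).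
Proof.
have := hL x (circ y); rewrite circK => ->.
have hx : linform (fun a => h x (circ a)) := (circ_bilform hH).2 x.
rewrite tsum_circ; last by apply: blin_balanced; lin.
by apply: eq_tsum => u v; rewrite circK.
Qed.

Lemma coef_rslice y z x : h (coef h y x) z = h (rslice z x) y.
Proof.
rewrite /coef /rslice /tsum !(hf_suml hH); apply: eq_bigr => p _.
by rewrite !(hfZl hH) mulrC.
Qed.

Definition perp (D : set H) : set H := [set x | forall y, D y -> h x y = 0].

(** For c orthogonal to D and z in D, invariance moves a slice of c against z to the legs of z,
    which lie in D, so it vanishes. For [rslice] this is left invariance and gives only T (rslice z
    c) = 0, from which T is cancelled by [antipode_inj]; for [coef] right invariance suffices.
    [coef_rslice] exchanges the two. *)
Lemma perp_subcoalgebra (D : set H) : subcoalgebra D -> subcoalgebra (perp D).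
Proof.
move=> DC; apply: slices_subcoalgebra => [|c y Dc z Dz|c y Dc z Dz].
- split=> [y _|a u v Du Dv y Dy]; first exact: (hf0l hH).
  by rewrite (hfDl hH) (hfZl hH) Du // Dv // mulr0 addr0.
- suff cz0 : rslice z c = 0 by rewrite coef_rslice cz0 (hf0l hH).
  have Tl : lin T by lin.
  have /(congr1 circ) : T (rslice z c) = 0.
    rewrite /rslice (lin_tsumE _ _ Tl).
    under eq_tsum do rewrite linearZ /=.
    rewrite left_invE.
    apply: (subcoalgebra_tsum DC Dz set0l) => [|u v Du Dv].
      have [|a u|] := balanced_antilin hH c (f := fun u => S (circ u)); last by [].
        by move=> u v; rewrite circD linearD.
      by rewrite circZ linearZ.
    by rewrite /= Dc // scale0r.
  by rewrite /= circK circ0 => /antipode_inj/(congr1 circ); rewrite circK circ0.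
- rewrite -coef_rslice coef_circ -[LHS]/(h _ _).
  suff -> : tsum (fun y1 y2 => h c y1 *: circ y2) (comul z) = 0.
    exact: (hf0l hH).
  apply: (subcoalgebra_tsum DC Dz set0l) => [|u v Du Dv].
    exact: (balanced_antilin hH c (@circD _ H) (@circZ _ H)).1.
  by rewrite /= Dc // scale0r.
Qed.

(** Right invariance and hermitian symmetry make [circ] exchange the two arguments of [coef]. Now d
    is a combination of the coef (e i) d, and these go to coef d (e i), slices of elements e i of
    D. *)
Lemma subcoalgebra_circ (D : set H) d : subcoalgebra D -> D d -> D (circ d).
Proof.
move=> DC Dd; have [s sD sE] := DC.2 d Dd.
have [|n [e [eo De es]]] := gram_schmidt hP (s := [seq p.1 | p <- s]) DC.1.
  by move=> _ /mapP[p /sD[? _] ->].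
have dE : comul d = \sum_(i < n) (e i ⊗ coef h (e i) d).
  rewrite {1}sE (tensor_expandl hP eo); first by rewrite -sE.
  by move=> p ps; apply: es; apply: map_f.
rewrite -[d]counitl dE tsum_sum; last by apply: blin_balanced; lin.
rewrite raddf_sum; apply: lin_closed_sum => [|i]; first exact: DC.1.
rewrite /= circZ; apply: lin_closedZ; first exact: DC.1.
rewrite coef_circ circ_tsum.
under eq_tsum do rewrite circZ circK -(hfC hH).
apply: (subcoalgebra_tsum DC (De i) DC.1) => [|u v _ Dv].
  by apply: blin_balanced; have := hl d => ?; lin.
exact: (lin_closedZ _ DC.1).
Qed.

(** The span of the matrix coefficients of a finite-dimensional coideal containing x: they satisfy
    the matrix coproduct rule [cC]. *)
Lemma finite_subcoalgebra x : exists (C : set H) N,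
  [/\ subcoalgebra C, C x & dim_le h C N].
Proof.
have [n [e [eo ex ce]]] := finite_coideal hP x.
pose c (i j : 'I_n) := coef h (e i) (e j).
pose C : set H := [set z | exists l : 'I_n -> 'I_n -> K,
  z = \sum_i \sum_j l i j *: c i j].
have Cl : lin_closed C.
  split.
    exists (fun _ _ => 0); rewrite big1 // => i _; rewrite big1 // => j _.
    by rewrite scale0r.
  move=> a u v [l ->] [l' ->]; exists (fun i j => a * l i j + l' i j).
  rewrite scaler_sumr -big_split; apply: eq_bigr => i _ /=.
  rewrite scaler_sumr -big_split; apply: eq_bigr => j _ /=.
  by rewrite scalerDl scalerA.
have Cc i j : C (c i j).
  exists (fun i' j' => ((i' == i) && (j' == j))%:R).
  rewrite (bigD1 i) //= [X in _ + X]big1 ?addr0; last first.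
    by move=> i' /negPf ->; rewrite big1 // => j' _; rewrite scale0r.
  rewrite (bigD1 j) //= !eqxx scale1r big1 ?addr0 // => j' /negPf ->.
  by rewrite scale0r.
have cC (i j : 'I_n) : comul (c i j) = \sum_(k < n) (c i k ⊗ c k j).
  have := hl (e i) => ?; rewrite {1}/c /coef (lin_tsumE (g := comul)); last by lin.
  transitivity (tsum (fun u q => tsum (fun w v => h u (e i) *: (w ⊗ v)) (comul q))
      (comul (e j))).
    apply: eq_tsum => u q; rewrite linearZ /= [comul q in LHS]tensor_repr.
    by rewrite scaler_sumr.
  rewrite -(coassoc (f := fun u w v => h u (e i) *: (w ⊗ v))); last by lin.
  transitivity (tsum (fun p v => coef h (e i) p ⊗ v) (comul (e j))).
    apply: eq_tsum => p v; rewrite /coef (lin_tsumE (g := fun z => z ⊗ v)); last by lin.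
    by apply: eq_tsum => u w; rewrite pureZl.
  rewrite ce ?proj_fam // tsum_sum //; apply: blin_balanced.
  by have := coef_lin hP (e i) => ?; lin.
have CC : subcoalgebra C.
  split=> // z [l ->].
  exists [seq (l t.1.1 t.1.2 *: c t.1.1 t.2, c t.2 t.1.2)
         | t <- enum {: 'I_n * 'I_n * 'I_n}].
    by move=> _ /mapP[[[i j] k] _ ->] /=; split=> //; apply: lin_closedZ.
  rewrite big_map big_enum /=.
  rewrite -(pair_bigA _ (fun t k => l t.1 t.2 *: c t.1 k ⊗ c k t.2)) /=.
  rewrite -(pair_bigA _ (fun i j => \sum_k (l i j *: c i k ⊗ c k j))) /=.
  rewrite linear_sum; apply: eq_bigr => i _; rewrite linear_sum.
  apply: eq_bigr => j _; rewrite linearZ /= cC scaler_sumr.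
  by apply: eq_bigr => k _; rewrite pureZl.
have Cx : C x.
  rewrite -[x]counitl ce // tsum_sum; last by apply: blin_balanced; lin.
  apply: lin_closed_sum => // i; apply: lin_closedZ => //.
  rewrite -ex /proj (lin_sum _ _ _ (coef_lin hP _)).
  apply: lin_closed_sum => // j; rewrite (linZ _ _ (coef_lin hP _)).
  by apply: (lin_closedZ _ Cl); apply: Cc.
have [|m [f [fo fC fc]]] := gram_schmidt hP
    (s := [seq c t.1 t.2 | t <- enum {: 'I_n * 'I_n}]) Cl.
  by move=> _ /mapP[t _ ->].
have pl := proj_lin hP m f.
exists C, m; split=> // k g go gC; apply: (onfam_bound hP fo go) => i.
have [l ->] := gC i; rewrite (lin_sum _ _ _ pl); apply: eq_bigr => a _.
rewrite (lin_sum _ _ _ pl); apply: eq_bigr => b _; rewrite (linZ _ _ pl) fc //.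
by apply/mapP; exists (a, b); rewrite ?mem_enum.
Qed.

(** If C is neither zero nor simple, a proper nonzero subcoalgebra D and its orthogonal complement F
    in C are both subcoalgebras of smaller dimension. *)
Lemma finite_subcoalgebra_semisimple N (C : set H) : subcoalgebra C ->
  dim_le h C N -> C `<=` sum_of (@simple_subcoalgebra K H).
Proof.
elim: N C => [|N IHN] C CC CN c Cc.
  (* For N = 0 a nonzero element would give an orthonormal family of length 1. *)
  have [->|/eqP c0] := eqVneq c 0; first exact: sum_of0.
  have o0 : onfam h 0 (fun=> 0) by case.
  have [|e [eo _ _ /(_ C CC.1 Cc) eC]] := onfam_extend hP o0 (v := c).
    by rewrite /proj big_ord0 => /esym.
  have eC1 : forall i : 'I_1, C (e i) by apply: eC; case.
  by have := CN _ _ eo eC1.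
have [Cs|Cns] := pselect (simple_subcoalgebra C); first exact: sum_of_mem Cs Cc.
have [C0|C0] := pselect (C = [set 0]).
  by move: Cc; rewrite C0 => ->; exact: sum_of0.
have [D [DC DsC [D0 DneC]]] : exists D, [/\ subcoalgebra D, D `<=` C &
    D <> [set 0] /\ D <> C].
  apply: contrapT => nD; apply: Cns; split=> // E EC EsC.
  apply: contrapT => /not_orP[E0 EneC]; apply: nD; by exists E.
have DN : dim_le h D N.+1 by move=> n e eo De; apply: (CN n e eo) => i; apply: DsC.
have [n [e [eo De eD]]] := dim_le_basis hP DC.1 DN.
pose F := C `&` perp D.
have FC : subcoalgebra F by apply: subcoalgebraI => //; apply: perp_subcoalgebra.
have res u : C u -> F (u - proj h n e u).
  move=> Cu; split.
    by apply: lin_closedB CC.1 _ _ => //; apply: DsC; apply: proj_in DC.1 _.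
  move=> y Dy; rewrite (hfBl hH) -(eD y Dy) !(hf_sumr hH) -sumrB big1 // => i _.
  by rewrite !(hfZr hH) ip_proj // subrr.
(* An orthonormal family of A can be lengthened inside C by the orthogonal vector b. It is applied
   to F with d from D, and to D with b from F. *)
have dim_step (A B : set H) b : A `<=` C -> C b -> b <> 0 ->
    (forall a, A a -> h b a = 0) -> dim_le h A N.
  move=> AC Cb b0 Ab m f fo fA; rewrite -ltnS.
  have [|f' [fo' _ _ /(_ C CC.1 Cb) fC']] := onfam_extend hP fo (v := b).
    by rewrite /proj big1 => [/esym//|i _]; rewrite Ab ?scale0r.
  by apply: (CN _ _ fo'); apply: fC' => i; apply: AC.
have [b [Fb b0]] : exists b, F b /\ b <> 0.
  apply: contrapT => nF; apply: DneC; apply/seteqP; split=> // u Cu.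
  have [u0|u0] := pselect (u - proj h n e u = 0); last first.
    by case: nF; exists (u - proj h n e u); split=> //; apply: res.
  by move/subr0_eq: u0 => ->; apply: proj_in DC.1 _.
have [d [Dd d0]] : exists d, D d /\ d <> 0.
  apply: contrapT => nD; apply: D0; apply/seteqP; split=> [d Dd|d ->]; last exact: DC.1.1.
  by apply: contrapT => d0; apply: nD; exists d.
rewrite -(subrK (proj h n e c) c); apply: sum_ofD.
  apply: (IHN F FC) (res _ Cc); apply: (dim_step F C d) => //; last first.
  - by move=> a [_ Fa]; rewrite (hfC hH) Fa // conjC0.
  - exact: DsC.
  - by move=> a [].
apply: (IHN D DC); last exact: proj_in DC.1 _.
by apply: (dim_step D C b) => //; [case: Fb|case: Fb].
Qed.

(** The element coef e d lies in D as a slice of d, and in E as the image under [circ] of a slice of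
    e. Since D and E meet in 0 it vanishes, and its counit is h d e. *)
Lemma simple_subcoalgebra_orthogonal (D E : set H) d e :
  simple_subcoalgebra D -> simple_subcoalgebra E -> D <> E -> D d -> E e ->
  h d e = 0.
Proof.
move=> [DC D0 Ds] [EC E0 Es] DE Dd Ee.
have IC := subcoalgebraI DC EC.
have I0 : D `&` E = [set 0].
  case: (Ds _ IC (@subIsetl _ _ _)) => // ID.
  case: (Es _ IC (@subIsetr _ _ _)) => // IE.
  by case: DE; rewrite -ID IE.
have : (D `&` E) (coef h e d).
  split; first exact: subcoalgebra_coef.
  rewrite coef_circ -[X in E X]circK circ_tsum; apply: subcoalgebra_circ => //.
  under eq_tsum do rewrite circZ circK -(hfC hH).
  apply: (subcoalgebra_tsum EC Ee EC.1) => [|u v _ Ev].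
    by apply: blin_balanced; have := hl d => ?; lin.
  exact: (lin_closedZ _ EC.1).
rewrite I0 => /(congr1 counit); rewrite linear0 => <-.
rewrite -[d in LHS]counitr /tsum (hf_suml hH) linear_sum.
by apply: eq_bigr => p _; rewrite (hfZl hH) linearZ [RHS]mulrC.
Qed.

Lemma cosemisimple_of_inner_product : cosemisimple H.
Proof.
split.
  apply/seteqP; split=> // x _; have [C [N [CC Cx CN]]] := finite_subcoalgebra x.
  exact: (finite_subcoalgebra_semisimple CC CN Cx).
move=> n D d Dinj Dd d0 j; apply: (ip_eq0 hP); rewrite -(hf0l hH (d j)) -d0.
rewrite (hf_suml hH) (bigD1 j) //= big1 ?addr0 // => i ij.
apply: (@simple_subcoalgebra_orthogonal (D i) (D j)); first by case: (Dd i).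
- by case: (Dd j).
- by move/Dinj => e; rewrite e eqxx in ij.
- by case: (Dd i).
- by case: (Dd j).
Qed.

End InvariantInnerProduct.

(** * The normal integral *)

Section SumOfDistinct.
Variables (K : fieldType) (C : coalgType K).

Definition fcons T n (x : T) (f : 'I_n -> T) (i : 'I_n.+1) : T :=
  if unlift ord0 i is Some j then f j else x.

Lemma fcons0 T n (x : T) (f : 'I_n -> T) : fcons x f ord0 = x.
Proof. by rewrite /fcons unlift_none. Qed.

Lemma fconsS T n (x : T) (f : 'I_n -> T) i : fcons x f (lift ord0 i) = f i.
Proof. by rewrite /fcons liftK. Qed.

Lemma fcons_inj T n (x : T) (f : 'I_n -> T) :
  injective f -> (forall i, f i <> x) -> injective (fcons x f).
Proof.
move=> finj fx i j.
case: (unliftP ord0 i) => [i' ->|->]; case: (unliftP ord0 j) => [j' ->|->];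
  rewrite ?fcons0 ?fconsS //.
- by move/finj->.
- by move/fx.
- by move/esym/fx.
Qed.

(** [sum_of] allows repeated subspaces while [independent] speaks of distinct ones; repetitions are
    merged here. *)
Lemma sum_of_distinct (P : set (set C)) x :
  (forall D, P D -> subspace D) -> sum_of P x ->
  exists n (D : 'I_n -> set C) d,
    [/\ injective D, forall i, P (D i) /\ D i (d i) & x = \sum_i d i].
Proof.
move=> Psub [n [D [d [Dd ->]]]]; elim: n => [|n IHn] in D d Dd *.
  by exists 0, D, d; split=> //; case.
rewrite big_ord_recl.
have [m [E [e [Einj Ee ->]]]] := IHn (fun i => D (lift ord0 i))
  (fun i => d (lift ord0 i)) (fun i => Dd _).
have [P0 D0] := Dd ord0.
have [[j Ej]|nE] := pselect (exists j, E j = D ord0); last first.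
  exists m.+1, (fcons (D ord0) E), (fcons (d ord0) e); split.
  - by apply: fcons_inj => // i Ei; apply: nE; exists i.
  - by move=> i; case: (unliftP ord0 i) => [i' ->|->]; rewrite ?fcons0 ?fconsS.
  - by rewrite big_ord_recl fcons0; congr (_ + _); apply: eq_bigr => i _; rewrite fconsS.
exists m, E, (fun i => if i == j then d ord0 + e j else e i); split=> // [i|].
  case: eqP => [->|_]; last exact: Ee.
  have [PE Eej] := Ee j; split=> //; apply: lin_closedD => //; first exact: Psub.
  by rewrite Ej.
rewrite (bigD1 j) // [RHS](bigD1 j) //= eqxx addrA; congr (_ + _).
by apply: eq_bigr => i /negPf ->.
Qed.

End SumOfDistinct.

Section NormalIntegral.
Variables (K : fieldType) (H : hopfAlgType K).

Lemma scalars_simple : simple_subcoalgebra (@scalars K H).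
Proof.
have sl : lin_closed (@scalars K H).
  split; first by exists 0; rewrite scale0r.
  by move=> a _ _ [b ->] [c ->]; exists (a * b + c); rewrite scalerDl scalerA.
split.
- split=> // _ [a ->]; exists [:: (a *: 1, 1)].
    move=> p; rewrite inE => /eqP ->; split; first by exists a.
    by exists 1; rewrite scale1r.
  by rewrite big_seq1 linearZ /= comul1 pureZl.
- move=> s0; have : scalars (1 : H) by exists 1; rewrite scale1r.
  by rewrite s0 => /eqP; rewrite oner_eq0.
- move=> E [El _] Es.
  have [E0|nE0] := pselect (E `<=` [set 0]).
    by left; apply/seteqP; split=> // _ ->; case: El.
  right; apply/seteqP; split=> // _ [a ->].
  have [x [Ex x0]] : exists x, E x /\ x <> 0.
    apply: contrapT => nx; apply: nE0 => x Ex /=.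
    by apply: contrapT => x0; apply: nx; exists x.
  have [b xb] := Es _ Ex.
  have b0 : b != 0 by apply/eqP => b0; apply: x0; rewrite xb b0 scale0r.
  rewrite -[a](mulfK b0) mulrAC -scalerA -xb.
  exact: (lin_closedZ _ El).
Qed.

(** Moving the scalar to the other side gives a vanishing sum over distinct simple subcoalgebras,
    with [scalars] prepended by [fcons]. *)
Lemma other_simple_scalar a : cosemisimple H ->
  sum_of (@other_simple K H) (a *: 1) -> a = 0.
Proof.
case=> _ ind sa.
have osub D : other_simple D -> @subspace K H D by case=> -[[]].
have [n [D [d [Dinj Dd aE]]]] := sum_of_distinct osub sa.
have inj : injective (fcons (@scalars K H) D).
  by apply: fcons_inj => // i Di; case: (Dd i) => -[_]; rewrite Di.
have /eqP : - (a *: 1) = 0 :> H.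
  rewrite -[LHS](fcons0 _ d); apply: (ind _ _ _ inj) => [i|].
    case: (unliftP ord0 i) => [i' ->|->]; rewrite ?fcons0 ?fconsS.
      by have [[]] := Dd i'.
    by split; [exact: scalars_simple|exists (- a); rewrite scaleNr].
  rewrite big_ord_recl fcons0 {1}aE.
  rewrite [X in _ + X](eq_bigr d) ?addNr // => i _; exact: fconsS.
by rewrite oppr_eq0 scaler_eq0 oner_eq0 orbF => /eqP.
Qed.

Hypothesis Hss : cosemisimple H.

Lemma sum_of_otherZ a (x : H) : 
  sum_of (@other_simple K H) x -> sum_of (@other_simple K H) (a *: x).
Proof.
move: x; apply: sum_of_ind => [|u v su sv|D d DO Dd].
- by rewrite scaler0; apply: sum_of0.
- by rewrite scalerDr; apply: sum_ofD.
- by apply: (sum_of_mem DO); apply: lin_closedZ => //; case: DO => -[[]].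
Qed.

Lemma normal_integralP x :
  sum_of (@other_simple K H) (x - normal_integral x *: 1).
Proof.
have /(xgetPex 0) : exists a : K, sum_of (@other_simple K H) (x - a *: 1).
  have : sum_of (@simple_subcoalgebra K H) x by rewrite Hss.1.
  move: x; apply: sum_of_ind => [|u v [a ua] [b vb]|D d Ds Dd].
  - by exists 0; rewrite scale0r subr0; apply: sum_of0.
  - by exists (a + b); rewrite scalerDl opprD addrACA; apply: sum_ofD.
  - have [Dsc|Dsc] := pselect (D = @scalars K H).
      by move: Dd; rewrite Dsc => -[a ->]; exists a; rewrite subrr; apply: sum_of0.
    by exists 0; rewrite scale0r subr0; apply: sum_of_mem Dd.
by [].
Qed.

Lemma normal_integral_unique x a :
  sum_of (@other_simple K H) (x - a *: 1) -> normal_integral x = a.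
Proof.
move=> xa; apply/eqP; rewrite -subr_eq0; apply/eqP/other_simple_scalar => //.
have -> : (normal_integral x - a) *: 1 =
    (x - a *: 1) + (-1) *: (x - normal_integral x *: 1) :> H.
  by rewrite scaleN1r opprB [RHS]addrC subrKA scalerBl.
by apply: sum_ofD => //; apply: sum_of_otherZ; apply: normal_integralP.
Qed.

Lemma normal_integral_lin : linform (@normal_integral K H).
Proof.
move=> a u v; apply: normal_integral_unique.
rewrite scalerDl -scalerA opprD addrACA -scalerBr.
by apply: sum_ofD; [apply: sum_of_otherZ|]; apply: normal_integralP.
Qed.

Lemma normal_integral1 : normal_integral (1 : H) = 1.
Proof. by apply: normal_integral_unique; rewrite scale1r subrr; apply: sum_of0. Qed.

Lemma normal_integral_other D d : other_simple D -> D d ->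
  normal_integral (d : H) = 0.
Proof.
move=> DO Dd; apply: normal_integral_unique; rewrite scale0r subr0.
exact: sum_of_mem DO Dd.
Qed.

(** Both invariance laws follow from [key]: the coproduct of an element of another simple
    subcoalgebra D has its legs in D, where the normal integral vanishes, so only the component
    along 1 contributes. *)
Lemma normal_integral_integral : integral (@normal_integral K H).
Proof.
have nl := normal_integral_lin.
have key (f : H -> H -> H) : blin f -> 
    (forall u v, normal_integral u = 0 -> normal_integral v = 0 -> f u v = 0) ->
    f 1 1 = 1 -> forall x, tsum f (comul x) = normal_integral x *: 1.
  move=> fl f0 f1 x.
  rewrite -{1}[x](subrK (normal_integral x *: 1)) linearD.
  rewrite (linD _ _ (lin_tsum fl (@lin_id _ _))) (linZ _ _ (lin_linear comul)) comul1.
  rewrite (linZ _ _ (lin_tsum fl (@lin_id _ _))) tsum_blin_pure // f1.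
  rewrite -[RHS]add0r; congr (_ + _); move: (normal_integralP x).
  move: (_ - _); apply: sum_of_ind => [|u v u0 v0|D d DO Dd].
  - by rewrite linear0 (lin0 (lin_tsum fl (@lin_id _ _))).
  - by rewrite linearD (linD _ _ (lin_tsum fl (@lin_id _ _))) u0 v0 addr0.
  - have [[DC _ _] _] := DO.
    apply: (subcoalgebra_tsum DC Dd (E := [set 0])).
    + by split=> // a u v /= -> ->; rewrite scaler0 addr0.
    + exact: blin_balanced.
    + by move=> u v Du Dv /=; apply: f0; apply: normal_integral_other DO _.
split=> //; first exact: normal_integral1.
- apply: key; [by lin| |by rewrite normal_integral1 scale1r].
  by move=> u v -> _; rewrite scale0r.
- apply: key; [by lin| |by rewrite normal_integral1 scale1r].
  by move=> u v _ ->; rewrite scale0r.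
Qed.

End NormalIntegral.

(** The sum of phi(x1) psi(x2) equals phi(x) by the invariance of phi and psi(x) by that of psi. One
    invariance law for each, on opposite sides, is what [right_inv_integral] can supply. *)
Lemma integral_unique (K : fieldType) (H : hopfAlgType K) (phi psi : H -> K) :
  linform phi -> phi 1 = 1 ->
  (forall x, tsum (fun a b => phi a *: b) (comul x) = phi x *: 1) ->
  linform psi -> psi 1 = 1 ->
  (forall x, tsum (fun a b => psi b *: a) (comul x) = psi x *: 1) ->
  phi =1 psi.
Proof.
move=> phil phi1 phiL psil psi1 psiR x.
transitivity (tsum (fun a b => phi a * psi b : K^o) (comul x)).
  have /(congr1 psi) := phiL x.
  rewrite (linZ _ _ psil) psi1 [RHS]mulr1 (lin_tsumE _ _ psil) => <-.
  by apply: eq_tsum => a b; rewrite (linZ _ _ psil).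
have /(congr1 phi) := psiR x.
rewrite (linZ _ _ phil) phi1 [RHS]mulr1 (lin_tsumE _ _ phil) => <-.
by apply: eq_tsum => a b; rewrite (linZ _ _ phil) [RHS]mulrC.
Qed.

(** * Unitary inner products on comodules *)

Lemma big_support (I : eqType) (M : nmodType) (F : I -> M) s t :
  uniq s -> uniq t ->
  (forall i, i \notin s -> F i = 0) -> (forall i, i \notin t -> F i = 0) ->
  \sum_(i <- s) F i = \sum_(i <- t) F i.
Proof.
move=> us ut Fs Ft.
rewrite (bigID (mem t)) [RHS](bigID (mem s)) /=.
rewrite [X in _ + X]big1 => [|i]; last exact: Ft.
rewrite [X in _ = _ + X]big1 => [|i]; last exact: Fs.
rewrite !addr0 -big_filter -[RHS]big_filter; apply: perm_big.
by apply: uniq_perm; rewrite ?filter_uniq // => i; rewrite !mem_filter andbC.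
Qed.

(** * Hamel bases and coordinate forms *)

Section HamelBasis.
Variables (K : fieldType) (V : lmodType K).
Implicit Types (B : set V) (s : seq V) (a : V -> K).

Let indep B := forall s a, uniq s -> (forall b, b \in s -> B b) ->
  \sum_(b <- s) a b *: b = 0 -> forall b, b \in s -> a b = 0.

Let represents B v a := exists s, [/\ uniq s, forall b, b \in s -> B b,
  forall b, b \notin s -> a b = 0 & v = \sum_(b <- s) a b *: b].

Lemma hamel_basis : exists B, indep B /\ forall v, exists a, represents B v a.
Proof.
have [|B [iB maxB]] := @Zorn_bigcup V indep.
  (* A finite subset of the union of a chain is empty or lies in one member of the chain. *)
  move=> F Fi Ft s a us sF; have [->//|[X FX sX]] :
      s = [::] \/ exists2 X, F X & forall b, b \in s -> X b.
    elim: s sF {us} => [|x s IHs] sF; [by left|right].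
    have [X FX Xx] := sF x (mem_head _ _).
    have [b bs|->|[Y FY sY]] := IHs; first by apply: sF; rewrite inE bs orbT.
      by exists X => // b; rewrite inE => /eqP ->.
    have [XY|YX] := Ft X Y FX FY.
      by exists Y => // b; rewrite inE => /orP[/eqP->|/sY//]; apply: XY.
    by exists X => // b; rewrite inE => /orP[/eqP->//|/sY/YX].
  exact: (Fi X FX).
exists B; split=> // v; apply: contrapT => nv.
have vB : ~ B v.
  move=> Bv; apply: nv; exists (fun b => (b == v)%:R), [:: v]; split=> //.
  - by move=> b; rewrite inE => /eqP ->.
  - by move=> b; rewrite inE => /negPf ->.
  - by rewrite big_seq1 eqxx scale1r.
apply: (maxB (B `|` [set v])).
  split=> [b Bb|sub]; [by left|by apply: vB; apply: sub; right].
move=> s a us sBv s0.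
have sB b : b \in s -> b != v -> B b by move=> /sBv[//|/= ->]; rewrite eqxx.
have [vs|vs] := boolP (v \in s); last first.
  apply: iB us _ s0 => b bs; apply: sB => //.
  by apply: contraNneq vs => <-.
have E : a v *: v + \sum_(b <- rem v s) a b *: b = 0.
  by move: s0; rewrite (big_rem v vs).
have rB b : b \in rem v s -> B b.
  by rewrite mem_rem_uniq // inE => /andP[bv bs]; apply: sB.
(* Otherwise the relation could be solved for v, giving it coordinates over B. *)
have av : a v = 0.
  apply/eqP/negPn/negP => av0; apply: nv.
  exists (fun b => if b \in rem v s then - (a v)^-1 * a b else 0), (rem v s).
  split=> // [|b /negPf -> //|]; first exact: rem_uniq.
  rewrite big_seq; under eq_bigr => b bs do rewrite bs -scalerA.
  rewrite -big_seq -scaler_sumr; move/eqP: E; rewrite addr_eq0 => /eqP E.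
  by rewrite scaleNr -scalerN -E scalerA mulVf // scale1r.
move: E; rewrite av scale0r add0r => E b bs.
have [->//|bv] := eqVneq b v.
by apply: (iB _ _ (rem_uniq v us) rB E); rewrite mem_rem_uniq // inE bv.
Qed.

(** Only these properties of a basis are used below: linear coordinate forms, finitely many of them
    nonzero at each vector, that jointly separate points. *)
Lemma hamel_coordinates : exists c : V -> V -> K,
  [/\ forall b, linform (c b), forall v, exists s, forall b, b \notin s -> c b v = 0
    & forall v, (forall b, c b v = 0) -> v = 0].
Proof.
have [B [iB repB]] := hamel_basis.
have rep_unique v a a' : represents B v a -> represents B v a' -> a =1 a'.
  move=> [s [us sB as0 ->]] [s' [us' sB' as0' sE]] b.
  pose t := undup (s ++ s').
  have st : {subset s <= t} by move=> x xs; rewrite mem_undup mem_cat xs.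
  have st' : {subset s' <= t} by move=> x xs; rewrite mem_undup mem_cat xs orbT.
  have [bt|bt] := boolP (b \in t); last first.
    by rewrite as0 ?as0' //; apply: contra bt; [apply: st'|apply: st].
  apply/eqP; rewrite -subr_eq0; apply/eqP.
  apply: (iB t (fun b => a b - a' b)) => //; first exact: undup_uniq.
    by move=> x; rewrite mem_undup mem_cat => /orP[/sB|/sB'].
  under eq_bigr do rewrite scalerBl.
  rewrite sumrB; apply/eqP; rewrite subr_eq0; apply/eqP.
  transitivity (\sum_(b <- s) a b *: b); last rewrite sE.
    apply: big_support => //; first exact: undup_uniq.
      by move=> x xt; rewrite as0 ?scale0r //; apply: contra xt; apply: st.
    by move=> x xs; rewrite as0 ?scale0r.
  apply: big_support => //; first exact: undup_uniq.
    by move=> x xs; rewrite as0' ?scale0r.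
  by move=> x xt; rewrite as0' ?scale0r //; apply: contra xt; apply: st'.
have [c cP] := choice repB.
exists (fun b v => c v b); split=> [b k u v|v|v v0].
- rewrite -[RHS]/((fun b => k * c u b + c v b) b).
  apply: rep_unique (cP _) _ b.
  have [s [us sB su uE]] := cP u; have [s' [us' sB' sv vE]] := cP v.
  pose t := undup (s ++ s').
  have st : {subset s <= t} by move=> x xs; rewrite mem_undup mem_cat xs.
  have st' : {subset s' <= t} by move=> x xs; rewrite mem_undup mem_cat xs orbT.
  exists t; split; first exact: undup_uniq.
  + by move=> x; rewrite mem_undup mem_cat => /orP[/sB|/sB'].
  + move=> x xt; rewrite su ?sv ?mulr0 ?addr0 //; apply: contra xt; [exact: st'|exact: st].
  + under eq_bigr do rewrite scalerDl -scalerA.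
    rewrite big_split /= -scaler_sumr; congr (_ *: _ + _).
      rewrite {1}uE; apply: big_support => //; first exact: undup_uniq.
        by move=> x xs; rewrite su ?scale0r.
      by move=> x xt; rewrite su ?scale0r //; apply: contra xt; apply: st.
    rewrite {1}vE; apply: big_support => //; first exact: undup_uniq.
      by move=> x xs; rewrite sv ?scale0r.
    by move=> x xt; rewrite sv ?scale0r //; apply: contra xt; apply: st'.
- by have [s [_ _ sv _]] := cP v; exists s.
- have [s [_ _ _ ->]] := cP v; rewrite big1 // => b _.
  by rewrite v0 scale0r.
Qed.

End HamelBasis.

Lemma dot_of_inner_product (K : numClosedFieldType) (V : lmodType K)
    (ip : V -> V -> K) : inner_product ip ->
  exists d : {dot V for Num.conj}, forall u v, d u v = ip u v.
Proof.
move=> [ipH ip0].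
pose mB := @isBilinear.Build K V V K *%R (Num.conj \; *%R) ip
  (fun y u v => linB u v (ipH.1 y)) (fun y u v => hfBr ipH u v y)
  (fun y a u => linZ a u (ipH.1 y)) (fun y a u => hfZr ipH a y u).
have hM x y : ip x y = (-1) ^+ false * (ip y x)^* by rewrite expr0 mul1r -(hfC ipH).
pose mH := @isHermitianSesquilinear.Build K V false Num.conj ip hM.
pose mD := @isDotProduct.Build K V ip ip0.
by exists (HB.pack_for {dot V for Num.conj} ip mB mH mD).
Qed.

Section UnitaryComodule.
Variables (K : numClosedFieldType) (H : circHopfAlgType K).
Variables (h : H -> H -> K) (hP : inner_product h).
Hypothesis hR : right_inv (fun x a => h x (circ a)).
Let hH : hermitian_form h := hP.1.

Lemma circ_coef x y : circ (coef h y x) = coef h x y.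
Proof.
rewrite /coef (right_invE hH hR) circ_tsum; apply: eq_tsum => u v.
by rewrite circZ circK -(hfC hH).
Qed.

(** Each [T b] is a comodule map from V to H ([Tcomul]), and together they are injective because the
    counit recovers the coordinates ([Tcounit]). The inner product is the sum over b of the
    pullbacks of h, finite by [Tsupp]. *)
Lemma comodule_unitary (V : lmodType K) (rho : {linear V -> tensor V H}) :
  right_comodule rho -> exists ip : {dot V for Num.conj}, unitary rho ip.
Proof.
move=> rhoC; have [c [cl cs c0]] := hamel_coordinates V.
pose T b (u : V) := tsum (fun u0 u1 => c b u0 *: u1) (rho u).
have cTl b : blin (fun u0 (u1 : H) => c b u0 *: u1) by have := cl b => ?; lin.
have Tl b : lin (T b) by apply: lin_tsum => //; lin.
have Tcounit b u : counit (T b u) = c b u.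
  rewrite /T (lin_tsumE (g := counit : H -> K^o)); last by lin.
  rewrite -[u in RHS]rhoC.2 (lin_tsumE _ _ (cl b)); apply: eq_tsum => u0 u1.
  by rewrite linearZ (linZ _ _ (cl b)) [LHS]mulrC.
have Tcomul b y u : coef h y (T b u) = tsum (fun u0 u1 => h (T b u0) y *: u1) (rho u).
  have hl : linform (h^~ y) := hH.1 y.
  have := cl b => clb.
  have bl : blin (fun x1 x2 : H => h x1 y *: x2) by lin.
  have := coef_lin hP y => cfl.
  rewrite {1}/T (lin_tsumE _ _ cfl).
  transitivity (tsum (fun u0 u1 =>
      tsum (fun a d => c b u0 *: (h a y *: d)) (comul u1)) (rho u)).
    apply: eq_tsum => u0 u1; rewrite (linZ _ _ cfl) /coef.
    by rewrite (lin_tsumE _ _ (lin_scaler _ (@lin_id _ _))).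
  rewrite -(comodule_assoc (f := fun u0 a d => c b u0 *: (h a y *: d)) _ rhoC);
    last by lin.
  apply: eq_tsum => u0 u1; rewrite /T (lin_tsumE _ _ hl) /tsum scaler_suml.
  by apply: eq_bigr => p _; rewrite (linZ _ _ hl) scalerA.
have Tsupp u : exists s : seq V, forall b, b \notin s -> T b u = 0.
  have [s sP] := choice cs.
  exists (flatten [seq s p.1 | p <- repr (rho u)]) => b bs.
  rewrite /T /tsum big_seq big1 // => p pr; rewrite sP ?scale0r //.
  apply: contra bs => bp; apply/flattenP; exists (s p.1) => //.
  by apply/mapP; exists p.
have [s0 s0P] := choice Tsupp.
pose s u := undup (s0 u).
have sP u b : b \notin s u -> T b u = 0 by rewrite mem_undup; apply: s0P.
have su u : uniq (s u) by apply: undup_uniq.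
pose ip u v := \sum_(b <- s u) h (T b u) (T b v).
(* A support of either argument may index the sum; additivity in u and hermitian symmetry need this
   freedom. *)
have ipE u v t : uniq t -> (forall b, b \notin t -> T b u = 0) \/
    (forall b, b \notin t -> T b v = 0) -> ip u v = \sum_(b <- t) h (T b u) (T b v).
  move=> ut tP; apply: big_support => // b bt; first by rewrite sP // (hf0l hH).
  by case: tP => tP; rewrite tP // ?(hf0l hH) // (hf0r hH).
have ipH : hermitian_form ip.
  split=> [y a u v|u v].
    rewrite -[RHS]/(a * ip u y + ip v y).
    rewrite !(ipE _ y (s y)) //; try by right=> b; apply: sP.
    rewrite mulr_sumr -big_split; apply: eq_bigr => b _ /=.
    by rewrite Tl (hfDl hH) (hfZl hH).
  rewrite (ipE u v (s v)) //; last by right=> b; apply: sP.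
  by rewrite rmorph_sum; apply: eq_bigr => b _; rewrite /= -(hfC hH).
have ipP : inner_product ip.
  split=> // u u0; rewrite lt_def sumr_ge0 ?andbT; last by move=> b _; apply: ip_ge0.
  apply: contraNneq u0 => /eqP; rewrite psumr_eq0; last by move=> b _; apply: ip_ge0.
  move/allP => z; apply/eqP/c0 => b; rewrite -Tcounit.
  have [/z/eqP/(ip_eq0 hP) ->|/sP ->] := boolP (b \in s u); exact: linear0.
have [d dE] := dot_of_inner_product ipP; exists d => u v.
transitivity (tsum (fun u0 u1 => \sum_(b <- s v) (h (T b u0) (T b v) *: u1)) (rho u)).
  apply: eq_tsum => u0 u1; rewrite dE (ipE _ _ (s v)) ?scaler_suml //.
  by right=> b; apply: sP.
rewrite {1}/tsum exchange_big /=.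
transitivity (\sum_(b <- s v) coef h (T b v) (T b u)).
  by apply: eq_bigr => b _; rewrite Tcomul.
(* The support of v is traded for that of u, over which the right-hand side is summed; [circ_coef]
   then matches the terms. *)
transitivity (\sum_(b <- s u) coef h (T b v) (T b u)).
  have cl0 y : coef h y 0 = 0 by apply: lin0; apply: coef_lin.
  apply: big_support => // b bs; last by rewrite [T b u]sP // cl0.
  by rewrite -circ_coef [T b v]sP // cl0 circ0.
symmetry.
transitivity (tsum (fun v0 v1 =>
    \sum_(b <- s u) (h (T b u) (T b v0) *: circ v1)) (rho v)).
  by apply: eq_tsum => v0 v1; rewrite dE /ip scaler_suml.
rewrite {1}/tsum exchange_big /=; apply: eq_bigr => b _.
rewrite -circ_coef Tcomul circ_tsum /tsum; apply: eq_bigr => p _.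
by rewrite circZ -(hfC hH).
Qed.

End UnitaryComodule.

(** * The characterization *)

Section Characterization.
Variables (K : numClosedFieldType) (H : circHopfAlgType K).
Local Notation S := (antipode : {linear H -> H}).
Local Notation T := (@coantipode K H : {linear H -> H}).

(** Polarization: positivity makes h u u real, and this is used at x + y and at x + i y. *)
Lemma hermitian_form_of_gt0 (V : lmodType K) (h : V -> V -> K) :
  (forall y, linform (h^~ y)) -> (forall x y z, h x (y + z) = h x y + h x z) ->
  (forall a x y, h x (a *: y) = a^* * h x y) ->
  (forall x, x != 0 -> 0 < h x x) -> hermitian_form h.
Proof.
move=> hl hrD hrZ h0; split=> // x y.
have hlD u v w : h (u + v) w = h u w + h v w := linD _ _ (hl w).
have hlZ a u w : h (a *: u) w = a * h u w := linZ _ _ (hl w).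
have hreal u : (h u u)^* = h u u.
  apply/CrealP; have [->|/h0/gtr0_real//] := eqVneq u 0.
  by rewrite (lin0 (hl 0)) rpred0.
have e1 : (h x y)^* + (h y x)^* = h x y + h y x.
  have := hreal (x + y); rewrite !hlD !hrD !rmorphD /= !hreal.
  by rewrite -!addrA => /addrI; rewrite !addrA => /(@addIr _ (h y y)).
have e2 : (h x y)^* - (h y x)^* = h y x - h x y.
  have := hreal (x + 'i *: y).
  rewrite !hlD !hrD !hlZ !hrZ !rmorphD /= !rmorphM /= !hreal conjCK conjCi.
  rewrite -!addrA => /addrI; rewrite !addrA [in RHS](mulrCA 'i).
  move=> /(@addIr _ (- 'i * ('i * h y y))) E.
  apply: (mulfI (neq0Ci K)).
  by rewrite !mulrBr -[- ('i * _)]mulNr E addrC mulNr.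
have : (h x y)^* *+ 2 = h y x *+ 2.
  rewrite (_ : (h x y)^* *+ 2 = ((h x y)^* - (h y x)^*) + ((h x y)^* + (h y x)^*));
    last by ring.
  by rewrite e1 e2; ring.
by move=> /eqP; rewrite eqr_pMn2r // => /eqP ->.
Qed.

Lemma cqg_of_positive : cosemisimple H ->
  (forall x : H, x != 0 -> 0 < normal_integral (S (circ x) * x)) ->
  compact_quantum_group H.
Proof.
move=> Hss h0; pose phi := @normal_integral K H.
have phiI : integral phi by exact: normal_integral_integral.
have [phil _ _ _] := phiI.
pose h x y := phi (S (circ y) * x).
have hP : inner_product h.
  split=> //; apply: hermitian_form_of_gt0 => // [y|x y z|a x y]; rewrite /h.
  - by lin.
  - by rewrite circD linearD mulrDl (linD _ _ phil).
  - by rewrite circZ linearZ /= -scalerAl (linZ _ _ phil).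
have hR : right_inv (fun x a => h x (circ a)) := integral_form_right_inv phiI.
by move=> V rho; apply: comodule_unitary hP hR _ _.
Qed.

(** The left regular coaction made into a right one by T, which reverses the coproduct and preserves
    the counit. *)
Definition cocoaction (x : H) : tensor H H := tsum (fun a b => b ⊗ T a) (comul x).

Lemma cocoaction_lin : lin cocoaction.
Proof. by rewrite /cocoaction; lin. Qed.

HB.instance Definition _ := GRing.isLinear.Build K H (tensor H H) *:%R cocoaction
  cocoaction_lin.

Lemma tsum_cocoaction (U : nmodType) (f : H -> H -> U) x : balanced f ->
  tsum f (cocoaction x) = tsum (fun a b => f b (T a)) (comul x).
Proof. exact: tsum_tsum_pure. Qed.

Lemma cocoaction_comodule : right_comodule (cocoaction : {linear H -> tensor H H}).
Proof.
have comulT (y : H) : comul (T y) = tsum (fun a b => T b ⊗ T a) (comul y).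
  rewrite [LHS]tensor_repr -[LHS]/(tsum (fun a b => a ⊗ b) _).
  by rewrite tsum_comul_coantipode //; lin.
split=> x /=.
- rewrite tsum_cocoaction; last by apply: blin_balanced; lin.
  rewrite [RHS]tsum_cocoaction; last by apply: blin_balanced; lin.
  transitivity (tsum (fun a b =>
      tsum (fun c d : H => d ⊗ (T c ⊗ T a)) (comul b)) (comul x)).
    by apply: eq_tsum => a b; rewrite tsum_cocoaction //; apply: blin_balanced; lin.
  rewrite -(coassoc (f := fun a c d => d ⊗ (T c ⊗ T a))); last by lin.
  apply: eq_tsum => a b; rewrite comulT (lin_tsumE _ _ (lin_purer _ (@lin_id _ _))) //.
- rewrite tsum_cocoaction; last by apply: blin_balanced; lin.
  under eq_tsum do rewrite counit_coantipode.
  exact: counitl.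
Qed.

Lemma unitary_right_inv (ip : {dot H for Num.conj}) :
  unitary (comul : {linear H -> tensor H H}) ip ->
  right_inv (fun x a => ip x (circ a)).
Proof.
move=> u x a; rewrite u tsum_circ; first by apply: eq_tsum => ? ?; rewrite circK.
have ipH := (inner_product_dot ip).1.
exact: (balanced_antilin ipH x (@circD _ H) (@circZ _ H)).1.
Qed.

Lemma unitary_left_inv (ip : {dot H for Num.conj}) :
  unitary (cocoaction : {linear H -> tensor H H}) ip ->
  left_inv (fun x a => ip x (circ a)).
Proof.
have ipH := (inner_product_dot ip).1; have ipl := ipH.1.
move=> u x a; have := u x (circ a).
rewrite tsum_cocoaction; last by apply: blin_balanced; have := ipl (circ a) => ?; lin.
move=> ->; have ba := balanced_antilin ipH x (@circD _ H) (@circZ _ H).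
rewrite tsum_cocoaction; last exact: ba.1.
have ix : linform (fun c => ip x (circ c)) := (circ_bilform ipH).2 x.
rewrite tsum_circ.
  by apply: eq_tsum => b c; rewrite coantipode_circ circK.
have SD (v w : H) : circ (T (v + w)) = circ (T v) + circ (T w).
  by rewrite linearD circD.
have SZ b (v : H) : circ (T (b *: v)) = b^* *: circ (T v).
  by rewrite linearZ /= circZ.
by have [] := balanced_antilin ipH x SD SZ.
Qed.

(** Right invariance at 1 gives one invariance law for phi; the conjugate of phi (circ x) satisfies
    the opposite one, and the two functionals agree by [integral_unique]. *)
Lemma right_inv_integral (ip : H -> H -> K) : inner_product ip ->
  right_inv (fun x a => ip x (circ a)) -> integral (fun x => ip x 1 / ip 1 1).
Proof.
move=> ipP ipR; have ipH := ipP.1; have ipl := ipH.1 1.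
pose phi x := ip x 1 / ip 1 1; rewrite -/phi.
have n1 : ip 1 1 != 0 by rewrite gt_eqF // (ip_gt0 ipP) // oner_eq0.
have phil : linform phi by apply: lin_kmull.
have phi1 : phi 1 = 1 by rewrite /phi mulfV.
have phiL x : tsum (fun a b => phi a *: b) (comul x) = phi x *: 1.
  have := ipR x 1; rewrite circ1 comul1.
  have ix : linform (fun c => ip x (circ c)) := (circ_bilform ipH).2 x.
  rewrite tsum_blin_pure; last by lin.
  rewrite circ1 /phi => e.
  under eq_tsum do rewrite mulrC -scalerA.
  rewrite -(lin_tsumE _ _ (lin_scaler _ (@lin_id _ _))) e scalerA.
  by rewrite mulrC.
pose psi x := (phi (circ x))^*.
have psil : linform psi.
  by move=> a u v; rewrite /psi circD circZ (phil _ _ _) rmorphD rmorphM /= conjCK.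
have psi1 : psi 1 = 1 by rewrite /psi circ1 phi1 conjC1.
have psiR x : tsum (fun a b => psi b *: a) (comul x) = psi x *: 1.
  have /(congr1 circ) := phiL (circ x).
  rewrite tsum_circ; last by apply: blin_balanced; lin.
  rewrite circ_tsum circZ circ1 => <-.
  by apply: eq_tsum => a b; rewrite circZ circK.
have e := integral_unique phil phi1 phiL psil psi1 psiR.
split=> // x; rewrite e -psiR; apply: eq_tsum => a b.
by rewrite e.
Qed.

Lemma positive_of_cqg : compact_quantum_group H -> cosemisimple H /\
  (forall x : H, x != 0 -> 0 < normal_integral (S (circ x) * x)).
Proof.
move=> cqg.
have [ip1 /unitary_right_inv ip1R] := cqg H comul (comul_comodule H).
have [ip2 /unitary_left_inv ip2L] := cqg H cocoaction cocoaction_comodule.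
have ip1P := inner_product_dot ip1; have ip2P := inner_product_dot ip2.
have phiI := right_inv_integral ip1P ip1R.
set phi := fun x => _ in phiI.
have hP := integral_inner_product phiI ip1P ip2P ip1R ip2L.
have [phil phi1 phiL _] := phiI.
have h0 (x : H) : x != 0 -> 0 < phi (S (circ x) * x) by move=> /(ip_gt0 hP).
have Hss : cosemisimple H.
  apply: (cosemisimple_of_inner_product hP).
  - exact: integral_form_right_inv.
  - exact: integral_form_left_inv.
  (* With y = circ x, S x = 0 makes h y y = phi (S x * y) vanish, so y = 0 by positivity. *)
  - move=> x Sx; apply/eqP/negPn/negP => x0.
    have /h0 : circ x != 0.
      by apply: contra_neq x0 => /(congr1 circ); rewrite circK circ0.
    by rewrite circK Sx mul0r (lin0 phil) ltxx.
split=> // x /h0; have [nl n1 _ nR] := normal_integral_integral Hss.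
by rewrite (integral_unique phil phi1 phiL nl n1 nR).
Qed.

End Characterization.

Theorem theorem6p9 (R : realType) (H : circHopfAlgType R[i]) :
  compact_quantum_group H <->
  cosemisimple H /\
  (forall x : H, x != 0 -> 0 < normal_integral (antipode (circ x) * x)).
Proof.
split; first exact: positive_of_cqg.
by case; apply: cqg_of_positive.
Qed.
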